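(* Let $V=\mathbb C^{0|2}$ with $\omega=\begin{pmatrix}0&1\\-1&0\end{pmatrix}$, so $\mathfrak{osp}(V;\omega)=\mathfrak{sp}_2(\mathbb C)$ and $\mathrm{sdim}(V)=-2$. Fix $\lambda\in\mathbb C$ and let $M$ be either the Verma module $M_\lambda$ of $\mathfrak{sp}_2$ with highest weight $\lambda$ or its simple quotient $L_\lambda$. Then the functor $\mathcal F^{TL}_M:\mathcal{PTL}(-2)\to\mathcal T_M(V)$ factors through $\mathcal{TLB}(-2,\lambda)$; that is, there exists a unique functor $\mathcal F^{TLB}_\lambda:\mathcal{TLB}(-2,\lambda)\to\mathcal T_M(V)$ such that $\mathcal F^{TL}_M$ is the composite of the quotient functor $\mathcal{PTL}(-2)\to\mathcal{TLB}(-2,\lambda)$ with $\mathcal F^{TLB}_\lambda$.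
   Context: **Lie theory.** $V=\mathbb C^{0|2}$ is purely odd. For the matrix form $\omega$ on a basis $e^1,e^2$, $g^{ab}=\omega(e^a,e^b)$, $(g_{ab})=(g^{ab})^{-1}$, $\{e_a\}$ is the basis with $\omega(e_a,e^b)=\delta_a^b$, $E^a_b$ the matrix units $E^c_b(e^a)=\delta^a_be^c$, and $X^a_b\in\mathfrak g=\mathfrak{sp}_2$ is the element $E^a_b+\sum_{a',b'}g^{aa'}g_{bb'}E^{b'}_{a'}$ of $\mathrm{End}(V)$. The tempered Casimir is $t=-\frac12\sum_{a,b}X^a_b\otimes X^b_a$; in terms of a standard basis $x,y,h$ of $\mathfrak{sp}_2=\mathfrak{sl}_2$ ($[h,x]=2x$, $[h,y]=-2y$, $[x,y]=h$), $t=-2(\frac12h\otimes h+x\otimes y+y\otimes x)$. Highest weight $\lambda$ means $h$ acts on the highest weight vector by $\lambda$. $\mu_M,\mu$ are the representations on $M,V$. Crossings below are sent to graded flips, on $V\otimes V$: $\tau(w\otimes w')=-w'\otimes w$; $\hat C(v\otimes v')=\omega(v,v')$; $\check C(1)=\sum_ae^a\otimes e_a$. $\mathcal T_M(V)$ is the full subcategory of $\mathfrak{sp}_2$-modules with objects $M\otimes V^{\otimes r}$, $r\in\mathbb N$. **The category $\mathcal{MPB}(\delta)$.** Words are finite (possibly empty) sequences in the letters $m,v$; $v^r$ denotes $r$ copies of $v$. A coloured Brauer diagram from a word $s$ to a word $t$ is a perfect matching of the set of bottom points (one per letter of $s$, left to right) and top points (one per letter of $t$) such that matched points carry the same letter and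 two points in the same row are matched only if their letter is $v$. Let $\mathcal{C}$ be the $\mathbb C$-linear strict monoidal category with words as objects, these diagrams as a basis of $\mathrm{Hom}(s,t)$, composition $BA$ given by stacking $B$ on top of $A$ and replacing each closed loop by the factor $\delta$, and $\otimes$ given by concatenation/juxtaposition. Write $I(s)$ for identities, $\mathbb I=I(m)$, $I=I(v)$, $X_{a,b}:(a,b)\to(b,a)$ for the crossing, $X(s,t):(s,t)\to(t,s)$ for the crossing of two blocks of parallel strands, $X=X_{v,v}$, $\cup:\emptyset\to(v,v)$, $\cap:(v,v)\to\emptyset$, $E=\cup\cap$. The multi-polar Brauer category $\mathcal{MPB}(\delta)$ is the $\mathbb C$-linear strict monoidal category obtained from $\mathcal C$ by freely adjoining morphisms $\mathbb H(a,b):(a,b)\to(a,b)$, $a,b\in\{m,v\}$, subject to, for all letters $a,b,c$ and words $w$: (i) $X(w,(a,b))(I(w)\otimes\mathbb H(a,b))=(\mathbb H(a,b)\otimes I(w))X(w,(a,b))$ and $X((a,b),w)(\mathbb H(a,b)\otimes I(w))=(I(w)\otimes\mathbb H(a,b))X((a,b),w)$; (ii) $X_{b,a}\mathbb H(b,a)=\mathbb H(a,b)X_{b,a}$; (iii) $(I\otimes\cap\otimes I(a))(X\otimes\mathbb H(v,a))(I\otimes\cup\otimes I(a))=-\mathbb H(v,a)$ and $(I(a)\otimes\cap\otimes I)(\mathbb H(a,v)\otimes X)(I(a)\otimes\cup\otimes I)=-\mathbb H(a,v)$; (iv) with $\mathbb H_{12}=\mathbb H(a,b)\otimes I(c)$,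 $\mathbb H_{23}=I(a)\otimes\mathbb H(b,c)$, $\mathbb H_{13}=(I(a)\otimes X_{c,b})(\mathbb H(a,c)\otimes I(b))(I(a)\otimes X_{b,c})$, one has $[\mathbb H_{12},\mathbb H_{13}+\mathbb H_{23}]=0=[\mathbb H_{12}+\mathbb H_{13},\mathbb H_{23}]$; (v) $\mathbb H(v,v)=X-E$. For $\delta\neq0$, $\mathcal{MTL}(\delta)=\mathcal{MPB}(\delta)/\langle\Theta\rangle$, where $\langle\Theta\rangle$ is the tensor ideal generated by $\Theta=X+I\otimes I-\frac2\delta E\in\mathrm{End}(v^2)$; $\mathcal{PTL}(\delta)$ is the full subcategory of $\mathcal{MTL}(\delta)$ with objects $(m,v^r)$, $r\in\mathbb N$. Put $Z_2=(\mathbb I\otimes\cap)(\mathbb H(m,v)^2\otimes I)(\mathbb I\otimes\cup)\in\mathrm{End}(m)$, which is central in $\mathcal{PTL}(\delta)$: $D(Z_2\otimes I(v^r))=(Z_2\otimes I(v^s))D$ for $D:(m,v^r)\to(m,v^s)$. $\mathcal{TLB}(\delta,\lambda)$ is the quotient category of $\mathcal{PTL}(\delta)$ obtained by setting $\frac{Z_2}\delta=-\lambda\left(\frac{\delta-2}2-\lambda\right)$ (that is, $Z_2\otimes I(v^r)$ is set equal to this scalar times $\delta$, for all $r$). **The functor $\mathcal F_M^{TL}$.** There is a monoidal functor from $\mathcal{MPB}(-2)$ to $\mathfrak{sp}_2$-modules with $m\mapsto M$, $v\mapsto V$, crossings $\mapsto$ graded flips, $\cup\mapsto\check C$, $\cap\mapsto\hat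 C$, $\mathbb H(a,b)\mapsto(\mu_A\otimes\mu_B)(t)$, where $A,B\in\{M,V\}$ are the images of $a,b$; its restriction to the full subcategory with objects $(m,v^r)$ factors uniquely through $\mathcal{PTL}(-2)$, giving $\mathcal F_M^{TL}:\mathcal{PTL}(-2)\to\mathcal T_M(V)$. *)

(* Defs.v *)
From HB Require Import structures.
From mathcomp Require Import all_boot all_order all_algebra.
From mathcomp Require Import generic_quotient boolp functions reals complex zify.
Set Implicit Arguments.
Unset Strict Implicit.
Unset Printing Implicit Defensive.
Import GRing.Theory.
Local Open Scope ring_scope.
Local Open Scope quotient_scope.

Section Partner.
Local Open Scope nat_scope.
Variables (G : finType) (s r : G -> G).
Hypotheses (sK : involutive s) (rK : involutive r).
Hypothesis sr : forall g, s g = g -> r g != g.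

Definition glue_rel : rel G := [rel g g' | (s g == g') || (r g == g')].

Lemma glue_sym : connect_sym glue_rel.
Proof.
apply: sym_connect_sym => a b /=.
by congr (_ || _); apply/eqP/eqP => <-; rewrite ?sK ?rK.
Qed.

(* Alternating s and r from a point fixed by one of them reaches exactly one
   other such point: this is why a stack of two diagrams is a diagram. *)
Lemma partner_half (x : G) (rx : r x = x) : exists y,
  [/\ y != x, (s y == y) || (r y == y), connect glue_rel x y &
   forall z, z != x -> (s z == z) || (r z == z) -> connect glue_rel x z ->
     z = y].
Proof.
pose p g := s (r g).
have pI : injective p by move=> a b /(inv_inj sK) /(inv_inj rK).
pose n := order p x.
have n0 : 0 < n by exact: order_gt0.
have pn : iter n p x = x by exact: iter_order.
have rp k : k <= n -> r (iter k p x) = iter (n - k) p x.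
  elim: k => [|k IH] kn; first by rewrite subn0 pn /= rx.
  have e (m : nat) : p (iter m p x) = iter m.+1 p x by [].
  apply: pI; rewrite e; have -> : (n - k.+1).+1 = n - k by lia.
  by rewrite -IH ?(ltnW kn) // iterS /p rK sK.
have sp k : 0 < k <= n -> s (iter k p x) = iter (n - k).+1 p x.
  case: k => // k /andP[_ kn].
  have -> : s (iter k.+1 p x) = r (iter k p x) by rewrite iterS /p sK.
  by rewrite rp ?(ltnW kn) //; congr (iter _ _ _); lia.
have inj i j : i < n -> j < n -> iter i p x = iter j p x -> i = j.
  by move=> Hi Hj e; rewrite -(findex_iter Hi) -(findex_iter Hj) e.
have n1 : 1 < n.
  rewrite ltn_neqAle n0 andbT; apply/eqP => e1.
  have e : s x = x by rewrite -[RHS]pn -e1 /= /p rx.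
  by have := sr e; rewrite rx eqxx.
have reach k : connect glue_rel x (iter k p x).
  elim: k => [|k IH]; first exact: connect0.
  apply: (connect_trans IH).
  apply: (@connect_trans _ _ (r (iter k p x))); apply: connect1 => /=.
    by apply/orP; right.
  by apply/orP; left.
have onorb z : connect glue_rel x z -> exists2 k, k < n & z = iter k p x.
  case/connectP => q; elim/last_ind: q z => [|q z' IH] z /=.
    by move=> _ ->; exists 0.
  rewrite rcons_path last_rcons => /andP[pq /= e] ->.
  have [k kn ek] := IH _ pq erefl.
  have fin m : exists2 k0, k0 < n & iter m p x = iter k0 p x.
    exists (m %% n); first by rewrite ltn_mod.
    rewrite {1}(divn_eq m n) addnC iterD; congr (iter _ _ _).
    elim: (m %/ n) => [//|a IHa].
    by rewrite mulSn addnC iterD pn.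
  move: e; rewrite ek; case/orP => /eqP <-.
    case: k kn {ek} => [|k] kn; last first.
      by rewrite sp ?(ltnW kn) //; exact: fin.
    by exists 1 => //=; rewrite /p rx.
  by rewrite rp ?(ltnW kn) //; exact: fin.
exists (iter (uphalf n) p x); split.
- apply/eqP => /(inj (uphalf n) 0) H.
  have : uphalf n = 0 by apply: H => //; lia.
  lia.
- case: (boolP (odd n)) => on.
    have e : (n - uphalf n).+1 = uphalf n by lia.
    by rewrite sp ?e ?eqxx //; lia.
  have e : n - uphalf n = uphalf n by lia.
  by rewrite rp ?e ?eqxx ?orbT //; lia.
- exact: reach.
move=> z zx ez /onorb[k kn ek]; move: zx ez; rewrite {z}ek => zx ez.
have k0 : 0 < k by case: k zx {kn ez} => //=; rewrite eqxx.
congr (iter _ _ _); case/orP: ez => /eqP; last first.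
  rewrite rp ?(ltnW kn) // => e; have : n - k = k by apply: inj => //; lia.
  lia.
rewrite sp ?k0 ?(ltnW kn) //.
case: (ltnP 1 k) => k1.
  move=> e; have : (n - k).+1 = k by apply: inj => //; lia.
  lia.
have -> : k = 1 by lia.
rewrite subn1 prednK // pn => e; have := inj 0 1 n0 n1 e; lia.
Qed.
End Partner.

Lemma glue_relC (G : finType) (s r : G -> G) :
  glue_rel s r =2 glue_rel r s.
Proof. by move=> a b; exact: orbC. Qed.

Lemma partnerP (G : finType) (s r : G -> G) (sK : involutive s)
    (rK : involutive r) (sr : forall g, s g = g -> r g != g) (x : G) :
  (s x == x) || (r x == x) -> exists y,
  [/\ y != x, (s y == y) || (r y == y), connect (glue_rel s r) x y &
   forall z, z != x -> (s z == z) || (r z == z) ->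
     connect (glue_rel s r) x z -> z = y].
Proof.
case/orP => /eqP ex; last exact: partner_half.
have rs g : r g = g -> s g != g.
  by move=> rg; apply/eqP => /sr; rewrite rg eqxx.
have [y [H1 H2 H3 H4]] := partner_half rK sK rs ex.
exists y; split => //; first by rewrite orbC.
  by rewrite (eq_connect (glue_relC s r)).
by move=> z ?; rewrite orbC (eq_connect (glue_relC s r)) => *; exact: H4.
Qed.

Inductive letter := Lm | Lv.
Definition letter_code a := if a is Lm then true else false.
Definition letter_decode (b : bool) := if b then Lm else Lv.
Lemma letter_codeK : cancel letter_code letter_decode. Proof. by case. Qed.
HB.instance Definition _ := Countable.copy letter (can_type letter_codeK).

Notation word := (seq letter).

Section Diagrams.

(* inl: bottom points (the source s); inr: top points (the target t) *)
Definition point (s t : word) : finType := ('I_(size s) + 'I_(size t))%type.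

Definition colour (s t : word) (p : point s t) : letter :=
  match p with inl i => nth Lv s i | inr j => nth Lv t j end.

Definition same_row (S T : Type) (p q : S + T) : bool :=
  match p, q with inl _, inl _ | inr _, inr _ => true | _, _ => false end.

Definition is_diagram (s t : word) (f : point s t -> point s t) :=
  forall p, [/\ f (f p) = p, f p <> p, colour (f p) = colour p &
                same_row p (f p) -> colour p = Lv].

(* A perfect matching is encoded by the fixed-point-free involution that maps
   each point to the point it is matched with. *)
Record diagram (s t : word) := Diagram {
  mate :> point s t -> point s t;
  mateP : is_diagram mate }.

Definition diag1_fun (s : word) (p : point s s) : point s s :=
  match p with inl i => inr i | inr i => inl i end.
Lemma diag1P s : is_diagram (@diag1_fun s). Proof. by case=> i; split. Qed.
Definition diag1 s : diagram s s := Diagram (@diag1P s).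

Section CatIndex.
Variables s t : word.
Definition catl (i : 'I_(size s)) : 'I_(size (s ++ t)) :=
  cast_ord (esym (size_cat s t)) (lshift (size t) i).
Definition catr (j : 'I_(size t)) : 'I_(size (s ++ t)) :=
  cast_ord (esym (size_cat s t)) (rshift (size s) j).
Definition catsplit (k : 'I_(size (s ++ t))) : 'I_(size s) + 'I_(size t) :=
  fintype.split (cast_ord (size_cat s t) k).

Lemma catsplitl i : catsplit (catl i) = inl i.
Proof. by rewrite /catsplit /catl cast_ordKV; exact: (unsplitK (inl i)). Qed.
Lemma catsplitr j : catsplit (catr j) = inr j.
Proof. by rewrite /catsplit /catr cast_ordKV; exact: (unsplitK (inr j)). Qed.
Lemma catsplitE k :
  k = match catsplit k with inl i => catl i | inr j => catr j end.
Proof.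
apply: (can_inj (cast_ordK (size_cat s t))); rewrite /catsplit.
rewrite -{1}[cast_ord _ k]splitK /unsplit.
by case: (fintype.split _) => i; rewrite /catl /catr cast_ordKV.
Qed.
Lemma nth_catl i : nth Lv (s ++ t) (catl i) = nth Lv s i.
Proof. by rewrite nth_cat /= ltn_ord. Qed.
Lemma nth_catr j : nth Lv (s ++ t) (catr j) = nth Lv t j.
Proof. by rewrite nth_cat /= ltnNge leq_addr /= addKn. Qed.
End CatIndex.

Section Crossing.
Variables s t : word.
Definition cross_fun (p : point (s ++ t) (t ++ s)) : point (s ++ t) (t ++ s) :=
  match p with
  | inl k => inr (match catsplit k with inl i => catr t i | inr j => catl s j end)
  | inr k => inl (match catsplit k with inl j => catr s j | inr i => catl t i end)
  end.
Lemma crossP : is_diagram cross_fun.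
Proof.
by case=> k; rewrite [k]catsplitE; case: (catsplit k) => i;
  rewrite /cross_fun /= ?(catsplitl, catsplitr); split;
  rewrite //= ?(nth_catl, nth_catr).
Qed.
Definition cross : diagram (s ++ t) (t ++ s) := Diagram crossP.
End Crossing.

Definition dcup_fun (p : point [::] [:: Lv; Lv]) : point [::] [:: Lv; Lv] :=
  match p with inl i => inl i | inr j => inr (rev_ord j) end.
Lemma dcupP : is_diagram dcup_fun.
Proof. by case=> -[[|[|k]] ik]; split=> //; do ?[congr inr]; apply/val_inj. Qed.
Definition dcup := Diagram dcupP.

Definition dcap_fun (p : point [:: Lv; Lv] [::]) : point [:: Lv; Lv] [::] :=
  match p with inl i => inl (rev_ord i) | inr j => inr j end.
Lemma dcapP : is_diagram dcap_fun.
Proof. by case=> -[[|[|k]] ik]; split=> //; do ?[congr inl]; apply/val_inj. Qed.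
Definition dcap := Diagram dcapP.

Section Juxtaposition.
Variables (s t s' t' : word) (A : diagram s t) (B : diagram s' t').
Definition juxl (p : point s t) : point (s ++ s') (t ++ t') :=
  match p with inl i => inl (catl s' i) | inr j => inr (catl t' j) end.
Definition juxr (p : point s' t') : point (s ++ s') (t ++ t') :=
  match p with inl i => inl (catr s i) | inr j => inr (catr t j) end.
Definition jux_split (p : point (s ++ s') (t ++ t')) :
    point s t + point s' t' :=
  match p with
  | inl k => match catsplit k with inl i => inl (inl i) | inr i => inr (inl i) end
  | inr k => match catsplit k with inl j => inl (inr j) | inr j => inr (inr j) end
  end.
Definition jux_fun (p : point (s ++ s') (t ++ t')) :=
  match jux_split p with inl q => juxl (A q) | inr q => juxr (B q) end.

Lemma jux_splitl p : jux_split (juxl p) = inl p.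
Proof. by case: p => i /=; rewrite catsplitl. Qed.
Lemma jux_splitr p : jux_split (juxr p) = inr p.
Proof. by case: p => i /=; rewrite catsplitr. Qed.
Lemma jux_splitE p :
  p = match jux_split p with inl q => juxl q | inr q => juxr q end.
Proof.
by case: p => k /=; rewrite {1}[k]catsplitE; case: (catsplit k).
Qed.
Lemma colour_juxl p : colour (juxl p) = colour p.
Proof. by case: p => i; exact: nth_catl. Qed.
Lemma colour_juxr p : colour (juxr p) = colour p.
Proof. by case: p => i; exact: nth_catr. Qed.

Lemma juxP : is_diagram jux_fun.
Proof.
move=> p; rewrite [p]jux_splitE /jux_fun.
case: (jux_split p) => q; rewrite ?(jux_splitl, jux_splitr).
  have [fK nf cf rf] := mateP A q; split; rewrite ?fK ?colour_juxl //.
    by move=> /(congr1 jux_split); rewrite !jux_splitl => -[].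
  by move=> rw; apply: rf; move: rw; case: (q) (A q) => ? [] ?.
have [fK nf cf rf] := mateP B q; split; rewrite ?fK ?colour_juxr //.
  by move=> /(congr1 jux_split); rewrite !jux_splitr => -[].
by move=> rw; apply: rf; move: rw; case: (q) (B q) => ? [] ?.
Qed.
Definition jux : diagram (s ++ s') (t ++ t') := Diagram juxP.
End Juxtaposition.

Section Stacking.
Variables (s t u : word) (B : diagram t u) (A : diagram s t).

(* bottom, middle (top of A glued to bottom of B) and top points *)
Definition spoint : finType := ('I_(size s) + 'I_(size t) + 'I_(size u))%type.

Definition lower_step (g : spoint) : spoint :=
  match g with inl p => inl (A p) | inr k => inr k end.
Definition upper_emb (p : point t u) : spoint :=
  match p with inl j => inl (inr j) | inr k => inr k end.
Definition upper_step (g : spoint) : spoint :=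
  match g with
  | inl (inl i) => inl (inl i)
  | inl (inr j) => upper_emb (B (inl j))
  | inr k => upper_emb (B (inr k))
  end.

Definition stack_rel : rel spoint := glue_rel lower_step upper_step.

Definition outer (p : point s u) : spoint :=
  match p with inl i => inl (inl i) | inr k => inr k end.

(* the other end of the strand that starts at p; see stack_partner *)
Definition stack_fun (p : point s u) : point s u :=
  odflt p [pick q | (q != p) && connect stack_rel (outer p) (outer q)].

(* closed loops are the components that meet no bottom or top point *)
Definition nloops : nat :=
  n_comp stack_rel [pred g | ~~ [exists p, connect stack_rel (outer p) g]].

Lemma lower_stepK : involutive lower_step.
Proof. by case=> // p /=; have [->] := mateP A p. Qed.

Lemma upper_step_emb p : upper_step (upper_emb p) = upper_emb (B p).
Proof. by case: p. Qed.

Lemma upper_stepK : involutive upper_step.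
Proof.
by case=> [[i|j]|k] //=; rewrite upper_step_emb;
  [have [->] := mateP B (inl j) | have [->] := mateP B (inr k)].
Qed.

Lemma lower_fix g : lower_step g = g -> exists k, g = inr k.
Proof.
by case: g => [p /= [] e|k]; [have [_ /(_ e)] := mateP A p | exists k].
Qed.

Lemma upper_emb_inj : injective upper_emb.
Proof. by case=> i [] j //= [->]. Qed.

Lemma upper_fix g : upper_step g = g -> exists i, g = inl (inl i).
Proof.
case: g => [[i|j]|k] //; first by exists i.
  by move=> /(@upper_emb_inj (B (inl j)) (inl j)) e;
     have [_ /(_ e)] := mateP B (inl j).
by move=> /(@upper_emb_inj (B (inr k)) (inr k)) e;
   have [_ /(_ e)] := mateP B (inr k).
Qed.

Lemma stack_nofix g : lower_step g = g -> upper_step g != g.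
Proof. by move=> /lower_fix[k ->]; apply/eqP => /upper_fix[]. Qed.

Definition endpoint g := (lower_step g == g) || (upper_step g == g).

Lemma outer_end p : endpoint (outer p).
Proof. by case: p => i; rewrite /endpoint eqxx ?orbT. Qed.

Lemma end_outer g : endpoint g -> exists p, g = outer p.
Proof.
by case/orP => /eqP; [move/lower_fix => [k ->]; exists (inr k)
                     |move/upper_fix => [i ->]; exists (inl i)].
Qed.

Lemma outer_inj : injective outer.
Proof. by case=> i [] j //= [->]. Qed.

Lemma stack_partner p : exists q,
  [/\ q != p, connect stack_rel (outer p) (outer q), stack_fun p = q &
    forall q', q' != p -> connect stack_rel (outer p) (outer q') -> q' = q].
Proof.
have [g [gp /end_outer[q eq] cg ug]] :=
  partnerP lower_stepK upper_stepK stack_nofix (outer_end p).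
have uq q' : q' != p -> connect stack_rel (outer p) (outer q') -> q' = q.
  move=> qp cq; apply: outer_inj; rewrite -eq; apply: ug => //.
  - by rewrite (inj_eq outer_inj).
  - exact: outer_end.
have qp : q != p by rewrite -(inj_eq outer_inj) -eq.
exists q; split=> //; first by rewrite -eq.
rewrite /stack_fun; case: pickP => [q' /andP[? ?]|/(_ q)]; first exact: uq.
by rewrite qp -eq cg.
Qed.

Definition scolour (g : spoint) : letter :=
  match g with
  | inl (inl i) => nth Lv s i | inl (inr j) => nth Lv t j | inr k => nth Lv u k
  end.

Lemma scolour_connect g g' : connect stack_rel g g' -> scolour g' = scolour g.
Proof.
have cl (p : point s t) : scolour (inl p) = colour p by case: p.
have cu (p : point t u) : scolour (upper_emb p) = colour p by case: p.
case/connectP => q; elim: q g => [|h q IH] g /=; first by move=> _ ->.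
case/andP => e pq /(IH _ pq) ->; case/orP: e => /eqP <-.
  by case: g => // p; rewrite [lower_step _]/= cl; have [_ _ ->] := mateP A p; rewrite -cl.
case: g => [[i|j]|k] //; rewrite [upper_step _]/= cu.
  by have [_ _ ->] := mateP B (inl j).
by have [_ _ ->] := mateP B (inr k).
Qed.

Lemma scolour_outer p : scolour (outer p) = colour p. Proof. by case: p. Qed.

Lemma stackP : is_diagram stack_fun.
Proof.
move=> p; have [q [qp cq fp uq]] := stack_partner p.
have cc : colour q = colour p by rewrite -!scolour_outer; exact: scolour_connect.
rewrite fp; split=> //.
- have [q' [_ _ -> u']] := stack_partner q; apply/esym/u'.
    by rewrite eq_sym.
  by rewrite (glue_sym lower_stepK upper_stepK).
- exact/eqP.
move=> rw; case ecol : (colour p) => //; exfalso.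
have step1 (x y : spoint) : lower_step x = y \/ upper_step x = y ->
    connect stack_rel x y.
  by move=> [] e; apply: connect1; rewrite /stack_rel /glue_rel /= e eqxx ?orbT.
case: p => [i|k] in qp cq fp uq cc rw ecol *.
- have [_ _ c1 r1] := mateP A (inl i).
  case e1 : (A (inl i)) c1 r1 => [i'|j] c1 r1.
    by have := r1 isT; rewrite /= in ecol * => e; rewrite e in ecol.
  have [_ _ c2 r2] := mateP B (inl j).
  case e2 : (B (inl j)) c2 r2 => [j'|k] c2 r2.
    by have := r2 isT; rewrite /= in ecol c1 * => e; rewrite -c1 e in ecol.
  have e := uq (inr k) isT; move: rw; rewrite -e //.
  apply: (@connect_trans _ _ (inl (inr j))); apply: step1.
    by left; rewrite /= e1.
  by right; rewrite /= e2.
- have [_ _ c1 r1] := mateP B (inr k).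
  case e1 : (B (inr k)) c1 r1 => [j|k'] c1 r1; last first.
    by have := r1 isT; rewrite /= in ecol * => e; rewrite e in ecol.
  have [_ _ c2 r2] := mateP A (inr j).
  case e2 : (A (inr j)) c2 r2 => [i|j'] c2 r2; last first.
    by have := r2 isT; rewrite /= in ecol c1 * => e; rewrite -c1 e in ecol.
  have e := uq (inl i) isT; move: rw; rewrite -e //.
  apply: (@connect_trans _ _ (inl (inr j))); apply: step1.
    by right; rewrite /= e1.
  by left; rewrite /= e2.
Qed.
Definition stack : diagram s u := Diagram stackP.
End Stacking.

End Diagrams.

(* A vector space presented by generators-and-relations data: a type with
   operations that satisfy the axioms only up to an equivalence relation. *)
Record premod (K : fieldType) := PreMod {
  pm_car :> Type;
  pm_eq : pm_car -> pm_car -> Prop;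
  pm_zero : pm_car;
  pm_add : pm_car -> pm_car -> pm_car;
  pm_scale : K -> pm_car -> pm_car;
  pm_refl : forall x, pm_eq x x;
  pm_sym : forall x y, pm_eq x y -> pm_eq y x;
  pm_trans : forall x y z, pm_eq x y -> pm_eq y z -> pm_eq x z;
  pm_congD : forall x x' y y', pm_eq x x' -> pm_eq y y' ->
    pm_eq (pm_add x y) (pm_add x' y');
  pm_congZ : forall a x x', pm_eq x x' -> pm_eq (pm_scale a x) (pm_scale a x');
  pm_addA : forall x y z,
    pm_eq (pm_add x (pm_add y z)) (pm_add (pm_add x y) z);
  pm_addC : forall x y, pm_eq (pm_add x y) (pm_add y x);
  pm_add0 : forall x, pm_eq (pm_add pm_zero x) x;
  pm_addN : forall x, pm_eq (pm_add (pm_scale (-1) x) x) pm_zero;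
  pm_scaleA : forall a b x,
    pm_eq (pm_scale a (pm_scale b x)) (pm_scale (a * b) x);
  pm_scale1 : forall x, pm_eq (pm_scale 1 x) x;
  pm_scaleDr : forall a x y,
    pm_eq (pm_scale a (pm_add x y)) (pm_add (pm_scale a x) (pm_scale a y));
  pm_scaleDl : forall a b x,
    pm_eq (pm_scale (a + b) x) (pm_add (pm_scale a x) (pm_scale b x)) }.

Section PremodQuotient.
Variables (K : fieldType) (S : premod K).

Definition pm_rel (x y : {classic S}) : bool := `[< pm_eq (x : S) (y : S) >].

Lemma pm_rel_equiv : equiv_class_of pm_rel.
Proof.
split=> [x|x y|y x z].
- by apply/asboolP; exact: pm_refl.
- by apply/asboolP/asboolP; exact: pm_sym.
- by move=> /asboolP xy /asboolP yz; apply/asboolP; exact: pm_trans xy yz.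
Qed.
Canonical pm_equiv := EquivRelPack pm_rel_equiv.

Definition pquot : Type := {eq_quot pm_equiv}.
HB.instance Definition _ := Choice.copy pquot {eq_quot pm_equiv}.

Definition pq (x : S) : pquot := \pi_({eq_quot pm_equiv}) (x : {classic S}).
Definition prepr (z : pquot) : S := repr (z : {eq_quot pm_equiv}).

Lemma preprK z : pq (prepr z) = z. Proof. exact: reprK. Qed.

Lemma pqP x y : pq x = pq y <-> pm_eq x y.
Proof.
split=> [/eqmodP/asboolP //|xy].
by apply/eqmodP/asboolP.
Qed.

Lemma prepr_pq x : pm_eq (prepr (pq x)) x.
Proof. by apply/pqP; rewrite preprK. Qed.

Lemma pquotW (P : pquot -> Prop) : (forall x, P (pq x)) -> forall z, P z.
Proof. by move=> H z; rewrite -[z]preprK. Qed.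

Let qadd (z w : pquot) := pq (pm_add (prepr z) (prepr w)).
Let qscale a (z : pquot) := pq (pm_scale a (prepr z)).

Let qaddE x y : qadd (pq x) (pq y) = pq (pm_add x y).
Proof. by apply/pqP/pm_congD; exact: prepr_pq. Qed.
Let qscaleE a x : qscale a (pq x) = pq (pm_scale a x).
Proof. by apply/pqP/pm_congZ; exact: prepr_pq. Qed.

Let qaddA : associative qadd.
Proof.
move=> z w t; elim/pquotW: z => x; elim/pquotW: w => y; elim/pquotW: t => u.
by rewrite !qaddE; apply/pqP/pm_addA.
Qed.
Let qaddC : commutative qadd.
Proof.
move=> z w; elim/pquotW: z => x; elim/pquotW: w => y.
by rewrite !qaddE; apply/pqP/pm_addC.
Qed.
Let qadd0 : left_id (pq (pm_zero S)) qadd.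
Proof. by elim/pquotW=> x; rewrite qaddE; apply/pqP/pm_add0. Qed.
Let qaddN : left_inverse (pq (pm_zero S)) (qscale (-1)) qadd.
Proof. by elim/pquotW=> x; rewrite qscaleE qaddE; apply/pqP/pm_addN. Qed.

HB.instance Definition _ :=
  GRing.isZmodule.Build pquot qaddA qaddC qadd0 qaddN.

Let qscaleA a b (z : pquot) : qscale a (qscale b z) = qscale (a * b) z.
Proof. by elim/pquotW: z => x; rewrite !qscaleE; apply/pqP/pm_scaleA. Qed.
Let qscale1 : left_id 1 qscale.
Proof. by elim/pquotW=> x; rewrite qscaleE; apply/pqP/pm_scale1. Qed.
Let qscaleDr : right_distributive qscale +%R.
Proof.
move=> a z w; elim/pquotW: z => x; elim/pquotW: w => y.
have addE u v : pq u + pq v = pq (pm_add u v) := qaddE u v.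
by rewrite addE !qscaleE addE; apply/pqP/pm_scaleDr.
Qed.
Let qscaleDl (z : pquot) : {morph qscale^~ z : a b / a + b}.
Proof.
move=> a b; elim/pquotW: z => x.
by rewrite !qscaleE; rewrite [RHS]qaddE; apply/pqP/pm_scaleDl.
Qed.

HB.instance Definition _ :=
  GRing.Zmodule_isLmodule.Build K pquot qscaleA qscale1 qscaleDr qscaleDl.

Lemma pq0 : 0 = pq (pm_zero S). Proof. by []. Qed.
Lemma pqD x y : pq (pm_add x y) = pq x + pq y. Proof. by rewrite -qaddE. Qed.
Lemma pqZ a x : pq (pm_scale a x) = a *: pq x. Proof. by rewrite -qscaleE. Qed.

End PremodQuotient.
Arguments pq {K S}.
Arguments prepr {K S}.

Section Tensor.
Variables (K : fieldType) (M N : lmodType K).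

(* M (x) N as formal sums of pure tensors modulo bilinearity *)
Inductive texp : Type :=
| TPure of M & N
| TZero
| TAdd of texp & texp
| TScale of K & texp.

Inductive teq : texp -> texp -> Prop :=
| teq_refl x : teq x x
| teq_sym x y : teq x y -> teq y x
| teq_trans x y z : teq x y -> teq y z -> teq x z
| teq_congD x x' y y' : teq x x' -> teq y y' -> teq (TAdd x y) (TAdd x' y')
| teq_congZ a x x' : teq x x' -> teq (TScale a x) (TScale a x')
| teq_addA x y z : teq (TAdd x (TAdd y z)) (TAdd (TAdd x y) z)
| teq_addC x y : teq (TAdd x y) (TAdd y x)
| teq_add0 x : teq (TAdd TZero x) x
| teq_addN x : teq (TAdd (TScale (-1) x) x) TZero
| teq_scaleA a b x : teq (TScale a (TScale b x)) (TScale (a * b) x)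
| teq_scale1 x : teq (TScale 1 x) x
| teq_scaleDr a x y : teq (TScale a (TAdd x y)) (TAdd (TScale a x) (TScale a y))
| teq_scaleDl a b x : teq (TScale (a + b) x) (TAdd (TScale a x) (TScale b x))
| teq_linl a u u' w :
    teq (TPure (a *: u + u') w) (TAdd (TScale a (TPure u w)) (TPure u' w))
| teq_linr a u w w' :
    teq (TPure u (a *: w + w')) (TAdd (TScale a (TPure u w)) (TPure u w')).

Definition texp_premod : premod K :=
  PreMod teq_refl teq_sym teq_trans teq_congD teq_congZ teq_addA teq_addC
    teq_add0 teq_addN teq_scaleA teq_scale1 teq_scaleDr teq_scaleDl.

Definition tensor : lmodType K := pquot texp_premod.

Definition tpure (u : M) (w : N) : tensor := pq (TPure u w : texp_premod).

Lemma tpure_linl a u u' w :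
  tpure (a *: u + u') w = a *: tpure u w + tpure u' w.
Proof. by rewrite -pqZ -pqD; apply/pqP; exact: teq_linl. Qed.

Lemma tpure_linr a u w w' :
  tpure u (a *: w + w') = a *: tpure u w + tpure u w'.
Proof. by rewrite -pqZ -pqD; apply/pqP; exact: teq_linr. Qed.

Lemma tensor_ind (P : tensor -> Prop) :
  P 0 -> (forall u w, P (tpure u w)) -> (forall x y, P x -> P y -> P (x + y)) ->
  (forall a x, P x -> P (a *: x)) -> forall x, P x.
Proof.
move=> P0 Pp PD PZ; apply: pquotW; elim=> [u w||x Px y Py|a x Px].
- exact: Pp.
- exact: P0.
- by have := PD _ _ Px Py; rewrite -pqD.
- by have := PZ a _ Px; rewrite -pqZ.
Qed.

Section Lift.
Variables (P : lmodType K) (f : M -> N -> P).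

Fixpoint tlift_exp (e : texp) : P :=
  match e with
  | TPure u w => f u w
  | TZero => 0
  | TAdd x y => tlift_exp x + tlift_exp y
  | TScale a x => a *: tlift_exp x
  end.

(* only meaningful for bilinear f, see tlift_pure and tlift_linear *)
Definition tlift (x : tensor) : P := tlift_exp (prepr x).

Definition bilinear_map : Prop :=
  (forall a u u' w, f (a *: u + u') w = a *: f u w + f u' w) /\
  (forall a u w w', f u (a *: w + w') = a *: f u w + f u w').

Hypothesis fbil : bilinear_map.

Lemma tlift_pq e : tlift (pq (e : texp_premod)) = tlift_exp e.
Proof.
rewrite /tlift; have := prepr_pq (e : texp_premod); move: (prepr _) => /= e'.
have [fl fr] := fbil.
elim=> {e e'} //= => [x y z _ -> _ -> //|x x' y y' _ -> _ -> //|a x x' _ -> //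
  |x y z|x y|x|x|a b x|x|a x y|a b x].
- by rewrite addrA.
- by rewrite addrC.
- by rewrite add0r.
- by rewrite scaleN1r addNr.
- by rewrite scalerA.
- by rewrite scale1r.
- by rewrite scalerDr.
- by rewrite scalerDl.
Qed.

Lemma tlift_pure u w : tlift (tpure u w) = f u w.
Proof. exact: tlift_pq. Qed.

Lemma tlift_linear a x y : tlift (a *: x + y) = a *: tlift x + tlift y.
Proof.
elim/pquotW: x => x; elim/pquotW: y => y.
by rewrite -pqZ -pqD !tlift_pq.
Qed.
End Lift.
End Tensor.
Arguments tpure {K M N}.
Notation "u *t w" := (tpure u w) (at level 40, left associativity).

Section Sp2.
Variable K : fieldType.

Definition omega_mx : 'M[K]_2 := \matrix_(i, j) ((i < j)%N%:R - (j < i)%N%:R).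

(* infinitesimal invariance of omega(u, w) = u^T omega w on column vectors *)
Definition is_sp2 : {pred 'M[K]_2} :=
  fun A => A^T *m omega_mx + omega_mx *m A == 0.

Lemma is_sp2_submod : submod_closed is_sp2.
Proof.
split=> [|a A B]; rewrite !unfold_in ?linear0 ?mul0mx ?mulmx0 ?addr0 //.
move=> /eqP HA /eqP HB; apply/eqP.
rewrite linearP /= mulmxDl mulmxDr -scalemxAl -scalemxAr addrACA HB addr0.
by rewrite -scalerDr HA scaler0.
Qed.
HB.instance Definition _ := GRing.isSubmodClosed.Build K 'M[K]_2 is_sp2 is_sp2_submod.

Record sp2 := Sp2 { sp2_mx :> 'M[K]_2; _ : is_sp2 sp2_mx }.
HB.instance Definition _ := [isSub for sp2_mx].
HB.instance Definition _ := [Choice of sp2 by <:].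
HB.instance Definition _ := [SubChoice_isSubLmodule of sp2 by <:].

Lemma sp2P (A : sp2) : A^T *m omega_mx = - (omega_mx *m A).
Proof. by apply/eqP; rewrite -addr_eq0; exact: (valP A). Qed.

Lemma lie_subproof (A B : sp2) : is_sp2 (A *m B - B *m A).
Proof.
have E (C D : sp2) : (C *m D)^T *m omega_mx = omega_mx *m (D *m C).
  have -> : (C *m D)^T = (D : 'M[K]_2)^T *m (C : 'M[K]_2)^T by rewrite trmx_mul.
  by rewrite -mulmxA (sp2P C) mulmxN !mulmxA (sp2P D) mulNmx opprK.
rewrite /is_sp2 linearB /= mulmxBl !E mulmxBr addrC.
by rewrite -[X in X + _]opprB addNr.
Qed.
Definition lie (A B : sp2) : sp2 := Sp2 (lie_subproof A B).

Lemma traceless_sp2 (A : 'M[K]_2) : A 0 0 + A 1 1 = 0 -> is_sp2 A.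
Proof.
move=> trA; have tr' : A 1 1 + A 0 0 = 0 by rewrite addrC.
have e0 (k : (0 < 2)%N) : Ordinal k = 0 :> 'I_2 by apply: val_inj.
have e1 (k : (1 < 2)%N) : Ordinal k = 1 :> 'I_2 by apply: val_inj.
apply/eqP/matrixP => i j; rewrite !mxE !big_ord_recl !big_ord0 !mxE.
have -> : lift ord0 ord0 = 1 :> 'I_2 by apply: val_inj.
case: i => -[|[|//]] ki; case: j => -[|[|//]] kj /=; rewrite ?e0 ?e1;
rewrite ?(subr0, sub0r, subrr, mulr0, mul0r, addr0, add0r, mulr1, mul1r,
    mulrN, mulNr) ?mulrN1 ?mulN1r ?addNr ?subrr ?trA //.
by rewrite -opprD tr' oppr0.
Qed.

(* E^c_b maps e^b to e^c, where e^1, e^2 is the standard basis of column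
   vectors; gup and glow are g^{ab} and g_{ab} *)
Definition matunit (c b : 'I_2) : 'M[K]_2 := delta_mx c b.
Definition gup (a b : 'I_2) : K := omega_mx a b.
Definition glow (a b : 'I_2) : K := invmx omega_mx a b.

Lemma invmx_omega : invmx omega_mx = - omega_mx.
Proof.
have H : (- omega_mx) *m omega_mx = 1%:M.
  apply/matrixP => i j; rewrite !mxE !big_ord_recl big_ord0 !mxE.
  case: i => -[|[|//]] ?; case: j => -[|[|//]] ? /=;
  by rewrite ?(subr0, sub0r, subrr, mulr0, mul0r, addr0, add0r, mulr1, mul1r,
    opprK, mulrN, oppr0, mulNr).
have U : omega_mx \in unitmx by case/mulmx1_unit: H.
by rewrite -[LHS]mul1mx -H -mulmxA mulmxV // mulmx1.
Qed.

Definition Xmx (a b : 'I_2) : 'M[K]_2 :=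
  matunit a b +
  \sum_(a' < 2) \sum_(b' < 2) (gup a a' * glow b b') *: matunit b' a'.

Lemma Xmx_sp2 a b : is_sp2 (Xmx a b).
Proof.
apply: traceless_sp2; rewrite /Xmx /glow invmx_omega /gup /matunit.
do ! (rewrite ?mxE ?big_ord_recl ?big_ord0 /=).
by case: a => -[|[|//]] ?; case: b => -[|[|//]] ? /=;
  rewrite ?(subr0, sub0r, subrr, mulr0, mul0r, addr0, add0r, mulr1, mul1r,
    opprK, mulrN, oppr0, mulNr, addNr).
Qed.
(* X_ a b is X^a_b *)
Definition X_ (a b : 'I_2) : sp2 := Sp2 (Xmx_sp2 a b).

Definition h_mx : 'M[K]_2 := delta_mx 0 0 - delta_mx 1 1.
Definition x_mx : 'M[K]_2 := delta_mx 0 1.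
Definition y_mx : 'M[K]_2 := delta_mx 1 0.

Lemma h_sp2 : is_sp2 h_mx.
Proof. by apply: traceless_sp2; rewrite !mxE /= subr0 sub0r subrr. Qed.
Lemma x_sp2 : is_sp2 x_mx.
Proof. by apply: traceless_sp2; rewrite !mxE /= addr0. Qed.
Lemma y_sp2 : is_sp2 y_mx.
Proof. by apply: traceless_sp2; rewrite !mxE /= addr0. Qed.
Definition sp2h : sp2 := Sp2 h_sp2.
Definition sp2x : sp2 := Sp2 x_sp2.
Definition sp2y : sp2 := Sp2 y_sp2.
End Sp2.

Record lincat (K : fieldType) := Lincat {
  ob :> Type;
  hom : ob -> ob -> lmodType K;
  idc : forall x, hom x x;
  comp : forall x y z, hom y z -> hom x y -> hom x z;
  compA : forall x y z w (f : hom z w) (g : hom y z) (h : hom x y),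
    comp f (comp g h) = comp (comp f g) h;
  comp1l : forall x y (f : hom x y), comp (idc y) f = f;
  comp1r : forall x y (f : hom x y), comp f (idc x) = f;
  comp_linl : forall x y z a (f f' : hom y z) (g : hom x y),
    comp (a *: f + f') g = a *: comp f g + comp f' g;
  comp_linr : forall x y z a (f : hom y z) (g g' : hom x y),
    comp f (a *: g + g') = a *: comp f g + comp f g' }.
Arguments hom {K l} x y.
Arguments idc {K l} x.
Arguments comp {K l x y z} f g.
Notation "f <o> g" := (comp f g) (at level 40, left associativity).

(* functors between K-linear categories are understood to be K-linear *)
Record functor (K : fieldType) (C D : lincat K) := Functor {
  fob :> C -> D;
  fmap : forall x y, hom x y -> hom (fob x) (fob y);
  fmap_id : forall x, fmap (idc x) = idc (fob x);
  fmap_comp : forall x y z (f : hom y z) (g : hom x y),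
    fmap (f <o> g) = fmap f <o> fmap g;
  fmap_lin : forall x y a (f g : hom x y),
    fmap (a *: f + g) = a *: fmap f + fmap g }.
Arguments fmap {K C D} f {x y} _ : rename.

Section Functors.
Variables (K : fieldType).

Lemma fcomp_id (C D E : lincat K) (G : functor D E) (F : functor C D) x :
  fmap G (fmap F (idc x)) = idc (G (F x)).
Proof. by rewrite !fmap_id. Qed.
Lemma fcomp_comp (C D E : lincat K) (G : functor D E) (F : functor C D) x y z
    (f : hom y z) (g : hom x y) :
  fmap G (fmap F (f <o> g)) = fmap G (fmap F f) <o> fmap G (fmap F g).
Proof. by rewrite !fmap_comp. Qed.
Lemma fcomp_lin (C D E : lincat K) (G : functor D E) (F : functor C D) x y a
    (f g : hom x y) :
  fmap G (fmap F (a *: f + g)) = a *: fmap G (fmap F f) + fmap G (fmap F g).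
Proof. by rewrite !fmap_lin. Qed.
Definition fcomp (C D E : lincat K) (G : functor D E) (F : functor C D) :
    functor C E :=
  @Functor K C E (fun x => G (F x)) (fun x y f => fmap G (fmap F f))
    (fcomp_id G F) (@fcomp_comp C D E G F) (@fcomp_lin C D E G F).

(* the full subcategory of C on a family of objects *)
Definition fullsub (C : lincat K) (T : Type) (i : T -> C) : lincat K :=
  @Lincat K T (fun x y => hom (i x) (i y)) (fun x => idc (i x))
    (fun x y z f g => f <o> g)
    (fun x y z w f g h => compA f g h) (fun x y f => comp1l f)
    (fun x y f => comp1r f) (fun x y z a f f' g => comp_linl a f f' g)
    (fun x y z a f g g' => comp_linr a f g g').

Definition frestrict (C D : lincat K) (F : functor C D) (T : Type) (i : T -> C) :
    functor (fullsub i) (fullsub (fun x => F (i x))) :=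
  @Functor K (fullsub i) (fullsub (fun x => F (i x))) (fun x => x)
    (fun x y f => fmap F f)
    (fun x => fmap_id F (i x)) (fun x y z f g => fmap_comp F f g)
    (fun x y a f g => fmap_lin F a f g).

Record ideal (C : lincat K) := Ideal {
  in_ideal :> forall x y : C, hom x y -> Prop;
  ideal0 : forall x y, in_ideal (0 : hom x y);
  idealD : forall x y (f g : hom x y), in_ideal f -> in_ideal g ->
    in_ideal (f + g);
  idealZ : forall x y a (f : hom x y), in_ideal f -> in_ideal (a *: f);
  ideall : forall x y z (f : hom y z) (g : hom x y), in_ideal g ->
    in_ideal (f <o> g);
  idealr : forall x y z (f : hom y z) (g : hom x y), in_ideal f ->
    in_ideal (f <o> g) }.

Section QuotientSpace.
Variables (L : lmodType K) (I : L -> Prop).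
Hypotheses (I0 : I 0) (ID : forall f g, I f -> I g -> I (f + g))
  (IZ : forall a f, I f -> I (a *: f)).
Let eqI (f g : L) := I (f - g).
Let eqI_of f g : f = g -> eqI f g.
Proof. by move=> ->; rewrite /eqI subrr. Qed.
Let eqI_sym f g : eqI f g -> eqI g f.
Proof. by move=> /(IZ (-1)); rewrite /eqI scaleN1r opprB. Qed.
Let eqI_trans f g h : eqI f g -> eqI g h -> eqI f h.
Proof. by move=> fg gh; have := ID fg gh; rewrite /eqI addrA subrK. Qed.
Let eqI_congD f f' g g' : eqI f f' -> eqI g g' -> eqI (f + g) (f' + g').
Proof. by move=> e e'; have := ID e e'; rewrite /eqI opprD addrACA. Qed.
Let eqI_congZ a f f' : eqI f f' -> eqI (a *: f) (a *: f').
Proof. by move=> /(IZ a); rewrite /eqI scalerBr. Qed.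

Definition quotsp_premod : premod K.
Proof.
refine (@PreMod K L eqI 0 +%R *:%R (fun x => eqI_of erefl) eqI_sym eqI_trans
  eqI_congD eqI_congZ _ _ _ _ _ _ _ _) => *; apply: eqI_of.
- exact: addrA.
- exact: addrC.
- exact: add0r.
- by rewrite scaleN1r addNr.
- exact: scalerA.
- exact: scale1r.
- exact: scalerDr.
- exact: scalerDl.
Defined.
End QuotientSpace.

Section QuotientCategory.
Variables (C : lincat K) (I : ideal C).

Definition qhom_premod (x y : C) : premod K :=
  quotsp_premod (@ideal0 C I x y) (@idealD C I x y) (@idealZ C I x y).
Definition qhom (x y : C) : lmodType K := pquot (qhom_premod x y).

Definition qclass x y (f : hom x y) : qhom x y := pq (f : qhom_premod x y).

Lemma qclassP x y (f g : hom x y) : qclass f = qclass g <-> I x y (f - g).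
Proof. exact: pqP. Qed.

Lemma qclass_lin x y a (f g : hom x y) :
  qclass (a *: f + g) = a *: qclass f + qclass g.
Proof. by rewrite /qclass -pqZ -pqD. Qed.

Definition qcomp x y z (f : qhom y z) (g : qhom x y) : qhom x z :=
  qclass ((prepr f : hom y z) <o> (prepr g : hom x y)).

Lemma qcompE x y z (f : hom y z) (g : hom x y) :
  qcomp (qclass f) (qclass g) = qclass (f <o> g).
Proof.
have cl (f1 f2 : hom y z) (g1 : hom x y) : (f1 - f2) <o> g1 = f1 <o> g1 - f2 <o> g1.
  by rewrite addrC -scaleN1r comp_linl scaleN1r addrC.
have cr (f1 : hom y z) (g1 g2 : hom x y) : f1 <o> (g1 - g2) = f1 <o> g1 - f1 <o> g2.
  by rewrite addrC -scaleN1r comp_linr scaleN1r addrC.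
apply/qclassP.
have If : I y z (prepr (qclass f) - f) := prepr_pq (f : qhom_premod y z).
have Ig : I x y (prepr (qclass g) - g) := prepr_pq (g : qhom_premod x y).
have := idealD (idealr (prepr (qclass g) : hom x y) If) (ideall f Ig).
by rewrite cl cr addrA subrK.
Qed.

Lemma qhom_ind x y (P : qhom x y -> Prop) :
  (forall f : hom x y, P (qclass f)) -> forall f, P f.
Proof. by move=> H; apply: pquotW. Qed.

Definition quotcat : lincat K.
Proof.
refine (@Lincat K C qhom (fun x => qclass (idc x)) qcomp _ _ _ _ _).
- move=> x y z w f g h; elim/qhom_ind: f => f; elim/qhom_ind: g => g.
  by elim/qhom_ind: h => h; rewrite !qcompE compA.
- by move=> x y; elim/qhom_ind=> f; rewrite qcompE comp1l.
- by move=> x y; elim/qhom_ind=> f; rewrite qcompE comp1r.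
- move=> x y z a f f' g; elim/qhom_ind: f => f; elim/qhom_ind: f' => f'.
  by elim/qhom_ind: g => g; rewrite -qclass_lin !qcompE -qclass_lin comp_linl.
- move=> x y z a f g g'; elim/qhom_ind: f => f; elim/qhom_ind: g' => g'.
  by elim/qhom_ind: g => g; rewrite -qclass_lin !qcompE -qclass_lin comp_linr.
Defined.

Definition quotfun : functor C quotcat :=
  @Functor K C quotcat (fun x => x) (fun x y f => qclass f)
    (fun x => erefl) (fun x y z f g => esym (qcompE f g))
    (fun x y a f g => qclass_lin a f g).
End QuotientCategory.

Inductive ideal_span (C : lincat K) (S : forall x y : C, hom x y -> Prop) :
    forall x y : C, hom x y -> Prop :=
| span_gen x y (f : hom x y) : S x y f -> ideal_span S f
| span0 x y : ideal_span S (0 : hom x y)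
| spanD x y (f g : hom x y) : ideal_span S f -> ideal_span S g ->
    ideal_span S (f + g)
| spanZ x y a (f : hom x y) : ideal_span S f -> ideal_span S (a *: f)
| spanl x y z (f : hom y z) (g : hom x y) : ideal_span S g ->
    ideal_span S (f <o> g)
| spanr x y z (f : hom y z) (g : hom x y) : ideal_span S f ->
    ideal_span S (f <o> g).

Definition gen_ideal (C : lincat K) (S : forall x y : C, hom x y -> Prop) :
    ideal C :=
  Ideal (@span0 C S) (@spanD C S) (@spanZ C S) (@spanl C S) (@spanr C S).
End Functors.

Section Sp2Modules.
Variable K : fieldType.

Record sp2mod := Sp2mod {
  sm_car :> lmodType K;
  act : sp2 K -> sm_car -> sm_car;
  act_linr : forall A a u w, act A (a *: u + w) = a *: act A u + act A w;
  act_linl : forall a A B u, act (a *: A + B) u = a *: act A u + act B u;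
  act_lie : forall A B u, act (lie A B) u = act A (act B u) - act B (act A u) }.
Arguments act {s}.

Section Hom.
Variables M N : sp2mod.

Definition is_sp2hom : {pred (M -> N)} := fun f =>
  `[< (forall a u w, f (a *: u + w) = a *: f u + f w) /\
      (forall A u, f (act A u) = act A (f u)) >].

Lemma act0 (L : sp2mod) A : act A (0 : L) = 0.
Proof. by have := act_linr A 1 (0 : L) 0; rewrite !scale1r addr0 => /eqP;
  rewrite -subr_eq subrr => /eqP <-. Qed.
Lemma actD (L : sp2mod) A (u w : L) : act A (u + w) = act A u + act A w.
Proof. by have := act_linr A 1 u w; rewrite !scale1r. Qed.
Lemma actZ (L : sp2mod) A a (u : L) : act A (a *: u) = a *: act A u.
Proof. by have := act_linr A a u 0; rewrite !addr0 act0 addr0. Qed.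

Lemma is_sp2hom_submod : submod_closed is_sp2hom.
Proof.
split=> [|c f g].
  by apply/asboolP; split=> *; rewrite /= ?scaler0 ?addr0 ?act0.
move=> /asboolP[fl fA] /asboolP[gl gA]; apply/asboolP; split=> [a u w|A u].
  have E v : (c *: f + g) v = c *: f v + g v by [].
  rewrite !E fl gl !scalerDr !scalerA -!addrA; congr (_ + _).
    by rewrite mulrC.
  by rewrite addrCA.
have E v : (c *: f + g) v = c *: f v + g v by [].
by rewrite !E fA gA actD actZ.
Qed.
HB.instance Definition _ :=
  GRing.isSubmodClosed.Build K (M -> N) is_sp2hom is_sp2hom_submod.

Record sp2hom := Sp2hom { sh_fun :> M -> N; _ : is_sp2hom sh_fun }.
HB.instance Definition _ := [isSub for sh_fun].
HB.instance Definition _ := [Choice of sp2hom by <:].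
HB.instance Definition _ := [SubChoice_isSubLmodule of sp2hom by <:].

Lemma sp2hom_lin (f : sp2hom) a u w : f (a *: u + w) = a *: f u + f w.
Proof. by case: f => f /= /asboolP[]. Qed.
Lemma sp2hom_act (f : sp2hom) A u : f (act A u) = act A (f u).
Proof. by case: f => f /= /asboolP[]. Qed.
End Hom.

Lemma sp2hom_idP M : @is_sp2hom M M (fun u => u).
Proof. by apply/asboolP. Qed.
Lemma sp2hom_compP M N P (f : sp2hom N P) (g : sp2hom M N) :
  @is_sp2hom M P (fun u => f (g u)).
Proof. by apply/asboolP; split=> *; rewrite !(sp2hom_lin, sp2hom_act). Qed.

Definition sp2cat : lincat K.
Proof.
refine (@Lincat K sp2mod sp2hom (fun M => Sp2hom (sp2hom_idP M))
  (fun M N P f g => Sp2hom (sp2hom_compP f g)) _ _ _ _ _) => * ;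
  apply: val_inj => //; apply/funext => u //=.
by rewrite !sp2hom_lin.
Defined.

Definition sp2iso (M N : sp2mod) : Prop :=
  exists (f : sp2hom M N) (g : sp2hom N M), cancel f g /\ cancel g f.

Definition is_simple (M : sp2mod) : Prop :=
  (exists u : M, u <> 0) /\
  forall P : M -> Prop, P 0 -> (forall a u w, P u -> P w -> P (a *: u + w)) ->
    (forall A u, P u -> P (act A u)) ->
    (forall u, P u -> u = 0) \/ (forall u, P u).

Definition triv_mod : sp2mod.
Proof.
by refine (@Sp2mod (K^o : lmodType K) (fun _ _ => 0) _ _ _) => *;
  rewrite ?scaler0 ?addr0 ?subr0.
Defined.

Definition V_mod : sp2mod.
Proof.
refine (@Sp2mod 'cV[K]_2 (fun A u => (A : 'M[K]_2) *m u) _ _ _) => [A a u w|a A B u|A B u] /=.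
- by rewrite mulmxDr scalemxAr.
- by rewrite mulmxDl scalemxAl.
- by rewrite mulmxBl !mulmxA.
Defined.

Section TensorModule.
Variables M N : sp2mod.

Definition tact (A : sp2 K) : tensor M N -> tensor M N :=
  tlift (fun u w => act A u *t w + u *t act A w).

Lemma tact_bil A : bilinear_map (fun (u : M) (w : N) => act A u *t w + u *t act A w).
Proof.
split=> *; rewrite act_linr ?tpure_linl ?tpure_linr scalerDr -!addrA;
  by congr (_ + _); rewrite addrCA.
Qed.
Lemma tact_pure A u w : tact A (u *t w) = act A u *t w + u *t act A w.
Proof. exact: (tlift_pure (tact_bil A)). Qed.
Lemma tact_linr A a x y : tact A (a *: x + y) = a *: tact A x + tact A y.
Proof. exact: (tlift_linear (tact_bil A)). Qed.

Lemma tact_linl a A B x : tact (a *: A + B) x = a *: tact A x + tact B x.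
Proof.
have t0 C : tact C 0 = 0.
  by have := tact_linr C (-1) 0 0; rewrite scaler0 addr0 scaleN1r addNr.
have tD C y z : tact C (y + z) = tact C y + tact C z.
  by have := tact_linr C 1 y z; rewrite !scale1r.
have tZ C b y : tact C (b *: y) = b *: tact C y.
  by have := tact_linr C b y 0; rewrite t0 !addr0.
elim/tensor_ind: x => [|u w|x y IHx IHy|b x IH].
- by rewrite !t0 scaler0 addr0.
- rewrite !tact_pure !act_linl tpure_linl tpure_linr scalerDr -!addrA.
  by congr (_ + _); rewrite addrCA.
- by rewrite !tD IHx IHy scalerDr addrACA.
- by rewrite !tZ IH scalerDr !scalerA mulrC.
Qed.

Lemma tact_lie A B x : tact (lie A B) x = tact A (tact B x) - tact B (tact A x).
Proof.
have t0 C : tact C 0 = 0.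
  by have := tact_linr C (-1) 0 0; rewrite scaler0 addr0 scaleN1r addNr.
have tD C y z : tact C (y + z) = tact C y + tact C z.
  by have := tact_linr C 1 y z; rewrite !scale1r.
have tZ C b y : tact C (b *: y) = b *: tact C y.
  by have := tact_linr C b y 0; rewrite t0 !addr0.
have pl (u u' : M) (w : N) : (u - u') *t w = u *t w - u' *t w.
  by rewrite addrC -scaleN1r tpure_linl scaleN1r addrC.
have pr (u : M) (w w' : N) : u *t (w - w') = u *t w - u *t w'.
  by rewrite addrC -scaleN1r tpure_linr scaleN1r addrC.
elim/tensor_ind: x => [|u w|x y IHx IHy|b x IH].
- by rewrite !t0 subr0.
- rewrite !tact_pure !tD !tact_pure !act_lie pl pr.
  set a := act A (act B u) *t w; set b := act B (act A u) *t w.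
  set c := u *t act A (act B w); set d := u *t act B (act A w).
  set e := act B u *t act A w; set f := act A u *t act B w.
  have -> : (a + e + (f + c)) = (a + c) + (e + f).
    by rewrite addrACA [e + c]addrC addrACA [f + e]addrC.
  have -> : (b + f + (e + d)) = (e + f) + (b + d).
    by rewrite addrACA [b + e]addrC addrACA.
  by rewrite addrKA opprD addrACA.
- by rewrite !tD IHx IHy opprD addrACA.
- by rewrite !tZ IH scalerBr.
Qed.

Definition tensor_mod : sp2mod := Sp2mod tact_linr tact_linl tact_lie.
End TensorModule.

Section Verma.
Variable lambda : K.

Inductive vexp : Type :=
| VGen
| VAct of sp2 K & vexp
| VZero
| VAdd of vexp & vexp
| VScale of K & vexp.

(* U(sp_2) / (U(sp_2) x + U(sp_2)(h - lambda)), the module induced from the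
   one-dimensional module of weight lambda over the span of h and x *)
Inductive veq : vexp -> vexp -> Prop :=
| veq_refl x : veq x x
| veq_sym x y : veq x y -> veq y x
| veq_trans x y z : veq x y -> veq y z -> veq x z
| veq_congD x x' y y' : veq x x' -> veq y y' -> veq (VAdd x y) (VAdd x' y')
| veq_congZ a x x' : veq x x' -> veq (VScale a x) (VScale a x')
| veq_congA A x x' : veq x x' -> veq (VAct A x) (VAct A x')
| veq_addA x y z : veq (VAdd x (VAdd y z)) (VAdd (VAdd x y) z)
| veq_addC x y : veq (VAdd x y) (VAdd y x)
| veq_add0 x : veq (VAdd VZero x) x
| veq_addN x : veq (VAdd (VScale (-1) x) x) VZero
| veq_scaleA a b x : veq (VScale a (VScale b x)) (VScale (a * b) x)
| veq_scale1 x : veq (VScale 1 x) x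
| veq_scaleDr a x y : veq (VScale a (VAdd x y)) (VAdd (VScale a x) (VScale a y))
| veq_scaleDl a b x : veq (VScale (a + b) x) (VAdd (VScale a x) (VScale b x))
| veq_actr A a x y :
    veq (VAct A (VAdd (VScale a x) y)) (VAdd (VScale a (VAct A x)) (VAct A y))
| veq_actl a A B x :
    veq (VAct (a *: A + B) x) (VAdd (VScale a (VAct A x)) (VAct B x))
| veq_lie A B x :
    veq (VAct (lie A B) x)
        (VAdd (VAct A (VAct B x)) (VScale (-1) (VAct B (VAct A x))))
| veq_x : veq (VAct (sp2x K) VGen) VZero
| veq_h : veq (VAct (sp2h K) VGen) (VScale lambda VGen).

Definition vexp_premod : premod K :=
  PreMod veq_refl veq_sym veq_trans veq_congD veq_congZ veq_addA veq_addC
    veq_add0 veq_addN veq_scaleA veq_scale1 veq_scaleDr veq_scaleDl.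

Definition vact (A : sp2 K) (x : pquot vexp_premod) : pquot vexp_premod :=
  pq (VAct A (prepr x) : vexp_premod).

Lemma vactE A e : vact A (pq (e : vexp_premod)) = pq (VAct A e : vexp_premod).
Proof. by apply/pqP/veq_congA; exact: (prepr_pq (e : vexp_premod)). Qed.

Definition verma : sp2mod.
Proof.
refine (@Sp2mod (pquot vexp_premod) vact _ _ _).
- move=> A a; elim/pquotW=> x; elim/pquotW=> y.
  by rewrite -pqZ -pqD !vactE -pqZ -pqD; apply/pqP; exact: veq_actr.
- move=> a A B; elim/pquotW=> x.
  by rewrite !vactE -pqZ -pqD; apply/pqP; exact: veq_actl.
- move=> A B; elim/pquotW=> x.
  by rewrite !vactE -scaleN1r -pqZ -pqD; apply/pqP; exact: veq_lie.
Defined.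
End Verma.

Definition is_simple_quotient (M N : sp2mod) : Prop :=
  is_simple M /\ exists f : sp2hom N M, forall u, exists w, f w = u.
End Sp2Modules.
Arguments act {K s}.

Section MPB.
Variables (K : fieldType) (delta : K).

(* Morphisms are K-linear monoidal expressions in the coloured Brauer diagrams
   and the adjoined BH, modulo the smallest congruence beq satisfying the axioms
   of a K-linear strict monoidal category, the multiplication rules of the
   diagram basis (beq_stack, beq_jux) and the defining relations of BH. *)
Inductive bterm : word -> word -> Type :=
| BDiag s t of diagram s t : bterm s t
| BH (a b : letter) : bterm [:: a; b] [:: a; b]
| BComp s t u of bterm t u & bterm s t : bterm s u
| BTens s t s' t' of bterm s t & bterm s' t' : bterm (s ++ s') (t ++ t')
| BZero s t : bterm s t
| BAdd s t of bterm s t & bterm s t : bterm s t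
| BScale s t of K & bterm s t : bterm s t.

Definition bcast s s' t t' (es : s = s') (et : t = t') (f : bterm s t) :
    bterm s' t' :=
  match es in _ = s1, et in _ = t1 return bterm s1 t1 with
  | erefl, erefl => f
  end.

Local Notation "f 'oo' g" := (BComp f g) (at level 40, left associativity).
Local Notation "f 'xx' g" := (BTens f g) (at level 38, right associativity).
Local Notation bI s := (BDiag (diag1 s)).
Local Notation bX s t := (BDiag (cross s t)).
Local Notation bcup := (BDiag dcup).
Local Notation bcap := (BDiag dcap).
Local Notation bH := BH.
Local Notation v := Lv.
Local Notation bcomm f g := (BAdd (f oo g) (BScale (-1) (g oo f))).

Definition bH12 a b c : bterm [:: a; b; c] [:: a; b; c] := bH a b xx bI [:: c].
Definition bH23 a b c : bterm [:: a; b; c] [:: a; b; c] := bI [:: a] xx bH b c.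
Definition bH13 a b c : bterm [:: a; b; c] [:: a; b; c] :=
  (bI [:: a] xx bX [:: c] [:: b]) oo (bH a c xx bI [:: b])
    oo (bI [:: a] xx bX [:: b] [:: c]).

Inductive beq : forall s t, bterm s t -> bterm s t -> Prop :=
| beq_refl s t (f : bterm s t) : beq f f
| beq_sym s t (f g : bterm s t) : beq f g -> beq g f
| beq_trans s t (f g h : bterm s t) : beq f g -> beq g h -> beq f h
| beq_congC s t u (f f' : bterm t u) (g g' : bterm s t) :
    beq f f' -> beq g g' -> beq (f oo g) (f' oo g')
| beq_congT s t s' t' (f f' : bterm s t) (g g' : bterm s' t') :
    beq f f' -> beq g g' -> beq (f xx g) (f' xx g')
| beq_congD s t (f f' g g' : bterm s t) :
    beq f f' -> beq g g' -> beq (BAdd f g) (BAdd f' g')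
| beq_congZ s t a (f f' : bterm s t) :
    beq f f' -> beq (BScale a f) (BScale a f')
| beq_addA s t (f g h : bterm s t) :
    beq (BAdd f (BAdd g h)) (BAdd (BAdd f g) h)
| beq_addC s t (f g : bterm s t) : beq (BAdd f g) (BAdd g f)
| beq_add0 s t (f : bterm s t) : beq (BAdd (BZero s t) f) f
| beq_addN s t (f : bterm s t) : beq (BAdd (BScale (-1) f) f) (BZero s t)
| beq_scaleA s t a b (f : bterm s t) :
    beq (BScale a (BScale b f)) (BScale (a * b) f)
| beq_scale1 s t (f : bterm s t) : beq (BScale 1 f) f
| beq_scaleDr s t a (f g : bterm s t) :
    beq (BScale a (BAdd f g)) (BAdd (BScale a f) (BScale a g))
| beq_scaleDl s t a b (f : bterm s t) :
    beq (BScale (a + b) f) (BAdd (BScale a f) (BScale b f))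
| beq_complinl s t u a (f f' : bterm t u) (g : bterm s t) :
    beq (BAdd (BScale a f) f' oo g) (BAdd (BScale a (f oo g)) (f' oo g))
| beq_complinr s t u a (f : bterm t u) (g g' : bterm s t) :
    beq (f oo BAdd (BScale a g) g') (BAdd (BScale a (f oo g)) (f oo g'))
| beq_tenslinl s t s' t' a (f f' : bterm s t) (g : bterm s' t') :
    beq (BAdd (BScale a f) f' xx g) (BAdd (BScale a (f xx g)) (f' xx g))
| beq_tenslinr s t s' t' a (f : bterm s t) (g g' : bterm s' t') :
    beq (f xx BAdd (BScale a g) g') (BAdd (BScale a (f xx g)) (f xx g'))
| beq_compA s t u w (f : bterm u w) (g : bterm t u) (h : bterm s t) :
    beq (f oo (g oo h)) (f oo g oo h)
| beq_comp1l s t (f : bterm s t) : beq (bI t oo f) f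
| beq_comp1r s t (f : bterm s t) : beq (f oo bI s) f
| beq_interchange s t u s' t' u' (f : bterm t u) (g : bterm s t)
    (f' : bterm t' u') (g' : bterm s' t') :
    beq ((f oo g) xx (f' oo g')) ((f xx f') oo (g xx g'))
| beq_tensA s t s' t' s'' t'' (f : bterm s t) (g : bterm s' t')
    (h : bterm s'' t'') :
    beq (bcast (catA s s' s'') (catA t t' t'') (f xx (g xx h)))
        ((f xx g) xx h)
| beq_tens1l s t (f : bterm s t) : beq (bI [::] xx f) f
| beq_tens1r s t (f : bterm s t) :
    beq (bcast (cats0 s) (cats0 t) (f xx bI [::])) f
| beq_stack s t u (B : diagram t u) (A : diagram s t) :
    beq (BDiag B oo BDiag A)
        (BScale (delta ^+ nloops B A) (BDiag (stack B A)))
| beq_jux s t s' t' (A : diagram s t) (B : diagram s' t') :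
    beq (BDiag A xx BDiag B) (BDiag (jux A B))
| beq_Hslidel w a b :
    beq (bX w [:: a; b] oo (bI w xx bH a b)) ((bH a b xx bI w) oo bX w [:: a; b])
| beq_Hslider w a b :
    beq (bX [:: a; b] w oo (bH a b xx bI w)) ((bI w xx bH a b) oo bX [:: a; b] w)
| beq_Hsym a b :
    beq (bX [:: b] [:: a] oo bH b a) (bH a b oo bX [:: b] [:: a])
| beq_Hskewl a :
    beq ((bI [:: v] xx bcap xx bI [:: a]) oo (bX [:: v] [:: v] xx bH v a)
           oo (bI [:: v] xx bcup xx bI [:: a]))
        (BScale (-1) (bH v a))
| beq_Hskewr a :
    beq ((bI [:: a] xx bcap xx bI [:: v]) oo (bH a v xx bX [:: v] [:: v])
           oo (bI [:: a] xx bcup xx bI [:: v]))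
        (BScale (-1) (bH a v))
| beq_4Tl a b c :
    beq (bcomm (bH12 a b c) (BAdd (bH13 a b c) (bH23 a b c))) (BZero _ _)
| beq_4Tr a b c :
    beq (bcomm (BAdd (bH12 a b c) (bH13 a b c)) (bH23 a b c)) (BZero _ _)
| beq_Hvv :
    beq (bH v v) (BAdd (bX [:: v] [:: v]) (BScale (-1) (bcup oo bcap))).

Definition mpb_premod (s t : word) : premod K :=
  PreMod (@beq_refl s t) (@beq_sym s t) (@beq_trans s t) (@beq_congD s t)
    (@beq_congZ s t) (@beq_addA s t) (@beq_addC s t) (@beq_add0 s t)
    (@beq_addN s t) (@beq_scaleA s t) (@beq_scale1 s t) (@beq_scaleDr s t)
    (@beq_scaleDl s t).

Definition mpb_hom (s t : word) : lmodType K := pquot (mpb_premod s t).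

Definition mpb_of s t (f : bterm s t) : mpb_hom s t := pq (f : mpb_premod s t).

Definition mpb_comp s t u (f : mpb_hom t u) (g : mpb_hom s t) : mpb_hom s u :=
  mpb_of (BComp (prepr f) (prepr g)).

Definition mpb_tens s t s' t' (f : mpb_hom s t) (g : mpb_hom s' t') :
    mpb_hom (s ++ s') (t ++ t') :=
  mpb_of (BTens (prepr f) (prepr g)).

Lemma mpb_ofP s t (f g : bterm s t) : mpb_of f = mpb_of g <-> beq f g.
Proof. exact: pqP. Qed.

Lemma mpb_compE s t u (f : bterm t u) (g : bterm s t) :
  mpb_comp (mpb_of f) (mpb_of g) = mpb_of (BComp f g).
Proof.
by apply/mpb_ofP/beq_congC; [exact: (prepr_pq (f : mpb_premod t u))
                            |exact: (prepr_pq (g : mpb_premod s t))].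
Qed.

Lemma mpb_tensE s t s' t' (f : bterm s t) (g : bterm s' t') :
  mpb_tens (mpb_of f) (mpb_of g) = mpb_of (BTens f g).
Proof.
by apply/mpb_ofP/beq_congT; [exact: (prepr_pq (f : mpb_premod s t))
                            |exact: (prepr_pq (g : mpb_premod s' t'))].
Qed.

Lemma mpb_ind s t (P : mpb_hom s t -> Prop) :
  (forall f, P (mpb_of f)) -> forall f, P f.
Proof. by move=> H; apply: pquotW. Qed.

Lemma mpb_of_lin s t a (f g : bterm s t) :
  mpb_of (BAdd (BScale a f) g) = a *: mpb_of f + mpb_of g.
Proof. by rewrite /mpb_of -pqZ -pqD. Qed.

Definition MPB : lincat K.
Proof.
refine (@Lincat K word mpb_hom (fun s => mpb_of (bI s)) mpb_comp _ _ _ _ _).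
- move=> x y z w f g h; elim/mpb_ind: f => f; elim/mpb_ind: g => g.
  elim/mpb_ind: h => h; rewrite !mpb_compE; apply/mpb_ofP; exact: beq_compA.
- move=> x y; elim/mpb_ind=> f; rewrite mpb_compE; apply/mpb_ofP.
  exact: beq_comp1l.
- move=> x y; elim/mpb_ind=> f; rewrite mpb_compE; apply/mpb_ofP.
  exact: beq_comp1r.
- move=> x y z a f f' g; elim/mpb_ind: f => f; elim/mpb_ind: f' => f'.
  elim/mpb_ind: g => g; rewrite -mpb_of_lin !mpb_compE -mpb_of_lin.
  apply/mpb_ofP; exact: beq_complinl.
- move=> x y z a f g g'; elim/mpb_ind: f => f; elim/mpb_ind: g' => g'.
  elim/mpb_ind: g => g; rewrite -mpb_of_lin !mpb_compE -mpb_of_lin.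
  apply/mpb_ofP; exact: beq_complinr.
Defined.

Definition mpb_diag s t (d : diagram s t) : hom (s : MPB) (t : MPB) :=
  mpb_of (BDiag d).
Definition mpb_H (a b : letter) : hom ([:: a; b] : MPB) ([:: a; b] : MPB) :=
  mpb_of (BH a b).

Definition mpb_X : hom ([:: v; v] : MPB) ([:: v; v] : MPB) :=
  mpb_diag (cross [:: v] [:: v]).
Definition mpb_E : hom ([:: v; v] : MPB) ([:: v; v] : MPB) :=
  mpb_diag dcup <o> mpb_diag dcap.

Definition Theta : hom ([:: v; v] : MPB) ([:: v; v] : MPB) :=
  mpb_X + mpb_tens (idc ([:: v] : MPB)) (idc ([:: v] : MPB))
    - (2 / delta) *: mpb_E.

(* the smallest tensor ideal that contains Theta (meaningful for delta != 0) *)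
Inductive theta_span : forall s t : MPB, hom s t -> Prop :=
| theta_gen : theta_span Theta
| theta0 s t : theta_span (0 : hom s t)
| thetaD s t (f g : hom s t) : theta_span f -> theta_span g ->
    theta_span (f + g)
| thetaZ s t a (f : hom s t) : theta_span f -> theta_span (a *: f)
| thetal s t u (f : hom t u) (g : hom s t) : theta_span g ->
    theta_span (f <o> g)
| thetar s t u (f : hom t u) (g : hom s t) : theta_span f ->
    theta_span (f <o> g)
| theta_tensl s t s' t' (f : mpb_hom s t) (g : mpb_hom s' t') : theta_span g ->
    theta_span (mpb_tens f g)
| theta_tensr s t s' t' (f : mpb_hom s t) (g : mpb_hom s' t') : theta_span f ->
    theta_span (mpb_tens f g).

Definition theta_ideal : ideal MPB :=
  Ideal theta0 thetaD thetaZ thetal thetar.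

Definition MTL : lincat K := quotcat theta_ideal.
Definition MTL_proj : functor MPB MTL := quotfun theta_ideal.

Definition pol (r : nat) : word := Lm :: nseq r Lv.

Definition PMPB : lincat K := @fullsub K MPB nat pol.
Definition PTL : lincat K := @fullsub K MTL nat pol.
Definition PTL_proj : functor PMPB PTL := @frestrict K MPB MTL MTL_proj nat pol.

Definition Hmv2 : mpb_hom [:: Lm; v] [:: Lm; v] := mpb_comp (mpb_H Lm v) (mpb_H Lm v).

Definition Z2 : hom ([:: Lm] : MPB) ([:: Lm] : MPB) :=
  mpb_comp (mpb_comp
    (mpb_tens (idc ([:: Lm] : MPB)) (mpb_diag dcap : mpb_hom _ _))
    (mpb_tens Hmv2 (idc ([:: v] : MPB))))
    (mpb_tens (idc ([:: Lm] : MPB)) (mpb_diag dcup : mpb_hom _ _)).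

(* the class of Z_2 (x) I(v^r) *)
Definition Z2r (r : nat) : hom (r : PTL) (r : PTL) :=
  fmap PTL_proj (mpb_tens Z2 (idc (nseq r v : MPB)) : hom (r : PMPB) (r : PMPB)).

Variable lambda : K.

Definition Z2_value : K := delta * (- lambda * ((delta - 2) / 2 - lambda)).

Inductive tlb_rel : forall r s : PTL, hom r s -> Prop :=
| tlb_rel_Z2 r : tlb_rel (Z2r r - Z2_value *: idc (r : PTL)).

Definition TLB : lincat K := quotcat (gen_ideal tlb_rel).
Definition TLB_proj : functor PTL TLB := quotfun (gen_ideal tlb_rel).
End MPB.

Section Representation.
Variables (K : fieldType) (M : sp2mod K).

Definition letter_mod (a : letter) : sp2mod K :=
  match a with Lm => M | Lv => V_mod K end.

Fixpoint word_mod (s : word) : sp2mod K :=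
  match s with
  | [::] => triv_mod K
  | a :: s' => tensor_mod (letter_mod a) (word_mod s')
  end.

(* the canonical bilinear map realizing the identification
   word_mod s (x) word_mod t = word_mod (s ++ t) *)
Fixpoint word_cat (s t : word) : word_mod s -> word_mod t -> word_mod (s ++ t) :=
  match s with
  | [::] => fun (k : K^o) y => k *: y
  | a :: s' => fun x y =>
      tlift (fun (u : letter_mod a) (w : word_mod s') => u *t word_cat w y) x
  end.

Definition pure1 (a : letter) (u : letter_mod a) : word_mod [:: a] :=
  u *t (1 : K^o).
Definition pure2 (a b : letter) (u : letter_mod a) (w : letter_mod b) :
    word_mod [:: a; b] := u *t (w *t (1 : K^o)).

Lemma word_cat_bil s t : bilinear_map (@word_cat s t).
Proof.
elim: s => [|a s [IHl IHr]]; first by split=> *; rewrite /= ?scalerDl ?scalerDr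
  ?scalerA // mulrC.
have B (y : word_mod t) : bilinear_map
    (fun (u : letter_mod a) (w : word_mod s) => u *t word_cat w y).
  by split=> *; rewrite ?IHl ?(tpure_linl, tpure_linr).
split=> [c x x' y|c x y y']; first exact: (tlift_linear (B y)).
elim/tensor_ind: x => [|u w|x x' Hx Hx'|b x Hx] /=.
- have t0 (z : word_mod t) : tlift (fun (u : letter_mod a) (w : word_mod s) =>
      u *t word_cat w z) 0 = 0.
    by have := tlift_linear (B z) (-1) 0 0; rewrite scaler0 addr0 scaleN1r addNr.
  by rewrite !t0 scaler0 addr0.
- by rewrite !tlift_pure // IHr tpure_linr.
- have tD z p q := tlift_linear (B z) 1 p q; rewrite /= in Hx Hx' *.
  have := tD (c *: y + y') x x'; rewrite !scale1r => ->; rewrite Hx Hx'.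
  have := tD y x x'; rewrite !scale1r => ->.
  have := tD y' x x'; rewrite !scale1r => ->.
  by rewrite scalerDr addrACA.
- have t0 (z : word_mod t) : tlift (fun (u : letter_mod a) (w : word_mod s) =>
      u *t word_cat w z) 0 = 0.
    by have := tlift_linear (B z) (-1) 0 0; rewrite scaler0 addr0 scaleN1r addNr.
  have tZ z p := tlift_linear (B z) b p 0; rewrite /= in Hx *.
  have := tZ (c *: y + y') x; rewrite t0 !addr0 => ->; rewrite Hx.
  have := tZ y x; rewrite t0 !addr0 => ->.
  have := tZ y' x; rewrite t0 !addr0 => ->.
  by rewrite scalerDr !scalerA mulrC.
Qed.

Lemma word_cat_pure a s t (u : letter_mod a) (w : word_mod s)
    (y : word_mod t) :
  @word_cat (a :: s) t (u *t w) y = u *t word_cat w y.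
Proof.
have [IHl IHr] := word_cat_bil s t.
have B : bilinear_map (fun (u : letter_mod a) (w : word_mod s) => u *t word_cat w y).
  by split=> *; rewrite ?IHl ?(tpure_linl, tpure_linr).
exact: (tlift_pure B).
Qed.

(* M is even and V is purely odd *)
Definition parity (a : letter) : bool := if a is Lv then true else false.

(* ebasis a is e^a, and ebasis_dual a is e_a, with omega e_a e^b = delta_a^b *)
Definition ebasis (a : 'I_2) : V_mod K := delta_mx a 0 : 'cV[K]_2.
Definition ebasis_dual (a : 'I_2) : V_mod K :=
  \sum_(b < 2) glow K a b *: (delta_mx b 0 : 'cV[K]_2).
Definition omega (u w : V_mod K) : K :=
  ((u : 'cV[K]_2)^T *m omega_mx K *m (w : 'cV[K]_2)) 0 0.

(* the action of the tempered Casimir t = -1/2 \sum X^i_j (x) X^j_i *)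
Definition Casimir_act (a b : letter) (u : letter_mod a) (w : letter_mod b) :
    word_mod [:: a; b] :=
  (- 2^-1) *: \sum_(i < 2) \sum_(j < 2) pure2 (act (X_ K i j) u) (act (X_ K j i) w).

(* A K-linear functor from MPB(-2) to sp_2-modules, given on objects by word_mod
   and monoidal for the identification word_cat, with the prescribed values on
   crossings, cup, cap and H; the pure tensors u (x) w span the source modules. *)
Record brauer_functor := BrauerFunctor {
  bf_map : forall s t : MPB (-2%:R : K), hom s t ->
    hom (word_mod s : sp2cat K) (word_mod t : sp2cat K);
  bf_id : forall s, bf_map (idc s) = idc (word_mod s : sp2cat K);
  bf_comp : forall s t u (f : hom t u) (g : hom s t),
    bf_map (f <o> g) = bf_map f <o> bf_map g;
  bf_lin : forall s t a (f g : hom s t),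
    bf_map (a *: f + g) = a *: bf_map f + bf_map g;
  bf_tens : forall s t s' t' (f : mpb_hom (-2%:R : K) s t)
      (g : mpb_hom (-2%:R : K) s' t') x y,
    bf_map (mpb_tens f g : hom (_ : MPB _) _) (word_cat x y) =
    word_cat (bf_map (f : hom (s : MPB _) _) x) (bf_map (g : hom (s' : MPB _) _) y);
  bf_cross : forall a b (u : letter_mod a) (w : letter_mod b),
    bf_map (mpb_diag _ (cross [:: a] [:: b])) (pure2 u w) =
    (-1) ^+ (parity a && parity b) *: pure2 w u;
  bf_cup : bf_map (mpb_diag _ dcup) (1 : K^o) =
    \sum_(a < 2) @pure2 Lv Lv (ebasis a) (ebasis_dual a);
  bf_cap : forall u w, bf_map (mpb_diag _ dcap) (@pure2 Lv Lv u w) = omega u w;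
  bf_H : forall a b u w, bf_map (mpb_H _ a b) (@pure2 a b u w) = Casimir_act u w }.

Definition bf_functor (F : brauer_functor) : functor (MPB (-2%:R : K)) (sp2cat K) :=
  @Functor K (MPB _) (sp2cat K) word_mod (bf_map F) (bf_id F) (@bf_comp F)
    (@bf_lin F).

Definition T_cat : lincat K :=
  @fullsub K (sp2cat K) nat (fun r => word_mod (pol r)).

Definition F_restrict (F : brauer_functor) : functor (PMPB (-2%:R : K)) T_cat :=
  @frestrict K (MPB _) (sp2cat K) (bf_functor F) nat pol.
End Representation.

(* Main.v *)
Require Import Defs.
From mathcomp Require Import all_boot all_order all_algebra.
From mathcomp Require Import boolp reals complex ring.
Import Defs.
Set Implicit Arguments.
Unset Strict Implicit.
Unset Printing Implicit Defensive.
Import GRing.Theory Num.Theory.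
Local Open Scope ring_scope.

(** Since [Z2] is a scalar in the quotient, the functor factors as soon as the
    image of [Z2] acts on [M] by that scalar, and the factorization is unique
    because a functor out of a quotient category is determined by its composite
    with the projection ([factor_through_quotcat]).

    The image of [Z2] is found by reading the diagram from the cup to the cap on
    a vector [u] of [M]: a copy of [V] and its dual are created, the tempered
    Casimir [t] acts twice on the product of [M] with the copy of [V], and [V] is
    closed off.  This is a partial trace over [V] of [t] squared.  The trace form
    of [V] is invariant, so the result is a multiple of the Casimir element: with
    [C = h h + 2 x y + 2 y x] it is [- 2 C] ([bf_Z2]).

    The operator [C] commutes with sp_2, hence acts on the Verma module, which
    is generated by a vector of weight [lambda] killed by [x], by its value
    [lambda ^+ 2 + 2 * lambda] on this vector ([casimir_verma]).  The same holds
    on every image of the Verma module ([casimir_scalar_surj]), and this covers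
    both choices of [M].  Finally [- 2 * (lambda ^+ 2 + 2 * lambda)] is the value
    [delta * (- lambda * ((delta - 2) / 2 - lambda))] at [delta = - 2]; the scalar
    is the same after adding strands on the right of [Z2], as [M (x) V^r] is
    spanned by tensors of the form [u (x) w] ([bf_Z2r_scalar]). *)

(** * Consequences of one-line linearity *)

Section OneLineLinear.
Variables (K : fieldType) (U W : lmodType K) (f : U -> W).
Hypothesis f_lin : forall a u w, f (a *: u + w) = a *: f u + f w.

Lemma lin0 : f 0 = 0.
Proof. by have := f_lin (-1) 0 0; rewrite scaler0 addr0 scaleN1r addNr. Qed.

Lemma linZ a u : f (a *: u) = a *: f u.
Proof. by have := f_lin a u 0; rewrite lin0 !addr0. Qed.

Lemma linD u w : f (u + w) = f u + f w.
Proof. by have := f_lin 1 u w; rewrite !scale1r. Qed.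

Lemma linN u : f (- u) = - f u.
Proof. by rewrite -scaleN1r linZ scaleN1r. Qed.
End OneLineLinear.

(** * Functors out of a quotient category *)

Lemma functor_eq (K : fieldType) (C D : lincat K) (f : C -> D)
    m m' i i' c c' l l' :
  (forall x y (g : hom x y), m x y g = m' x y g) ->
  @Functor K C D f m i c l = @Functor K C D f m' i' c' l'.
Proof.
move=> e; have {e} e : m = m'.
  by apply: functional_extensionality_dep => x;
     apply: functional_extensionality_dep => y; apply: funext => g.
rewrite {}e in i c l *.
by rewrite (Prop_irrelevance i i') (Prop_irrelevance c c') (Prop_irrelevance l l').
Qed.

Lemma fmap0 (K : fieldType) (C D : lincat K) (F : functor C D) x y :
  fmap F (0 : hom x y) = 0.
Proof. exact: (lin0 (@fmap_lin _ _ _ F x y)). Qed.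

Lemma fmapZ (K : fieldType) (C D : lincat K) (F : functor C D) x y a
    (f : hom x y) :
  fmap F (a *: f) = a *: fmap F f.
Proof. exact: (linZ (@fmap_lin _ _ _ F x y)). Qed.

Lemma fmapD (K : fieldType) (C D : lincat K) (F : functor C D) x y
    (f g : hom x y) :
  fmap F (f + g) = fmap F f + fmap F g.
Proof. exact: (linD (@fmap_lin _ _ _ F x y)). Qed.

Lemma fmapB (K : fieldType) (C D : lincat K) (F : functor C D) x y
    (f g : hom x y) :
  fmap F (f - g) = fmap F f - fmap F g.
Proof. by rewrite fmapD -scaleN1r fmapZ scaleN1r. Qed.

Lemma comp0r (K : fieldType) (C : lincat K) (x y z : C) (g : hom y z) :
  g <o> (0 : hom x y) = 0.
Proof. exact: (lin0 (fun a => comp_linr a g)). Qed.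

Lemma comp0l (K : fieldType) (C : lincat K) (x y z : C) (g : hom x y) :
  (0 : hom y z) <o> g = 0.
Proof. exact: (lin0 (fun a f f' => comp_linl a f f' g)). Qed.

Section Factorization.
Variables (K : fieldType) (C D : lincat K).

Definition kills (F : functor C D) (S : forall x y : C, hom x y -> Prop) :=
  forall x y (f : hom x y), S x y f -> fmap F f = 0.

Lemma kills_gen_ideal (F : functor C D) (S : forall x y : C, hom x y -> Prop) :
  kills F S -> kills F (gen_ideal S).
Proof.
move=> FS x y f; elim=> {x y f}.
- exact: FS.
- by move=> x y; exact: fmap0.
- by move=> x y f g _ Hf _ Hg; rewrite fmapD Hf Hg addr0.
- by move=> x y a f _ Hf; rewrite fmapZ Hf scaler0.
- by move=> x y z f g _ Hg; rewrite fmap_comp Hg comp0r.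
- by move=> x y z f g _ Hf; rewrite fmap_comp Hf comp0l.
Qed.

Variable I : ideal C.

Section Descend.
Variables (F : functor C D) (FI : kills F I).

Definition descend_map (x y : C) (f : qhom I x y) : hom (F x) (F y) :=
  fmap F (prepr f : hom x y).

Lemma descend_mapE x y (f : hom x y) : descend_map (qclass I f) = fmap F f.
Proof.
apply/subr0_eq; rewrite /descend_map -fmapB; apply: FI.
exact: (prepr_pq (f : qhom_premod I x y)).
Qed.

Lemma descend_id (x : quotcat I) : descend_map (idc x) = idc (F x).
Proof. by rewrite [LHS]descend_mapE fmap_id. Qed.

Lemma descend_comp (x y z : quotcat I) (f : hom y z) (g : hom x y) :
  descend_map (f <o> g) = descend_map f <o> descend_map g.
Proof.
elim/qhom_ind: f => f; elim/qhom_ind: g => g.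
by rewrite [_ <o> _]qcompE !descend_mapE fmap_comp.
Qed.

Lemma descend_lin (x y : quotcat I) a (f g : hom x y) :
  descend_map (a *: f + g) = a *: descend_map f + descend_map g.
Proof.
elim/qhom_ind: f => f; elim/qhom_ind: g => g.
by rewrite -qclass_lin !descend_mapE fmap_lin.
Qed.

Definition descend : functor (quotcat I) D :=
  @Functor K (quotcat I) D F descend_map descend_id descend_comp descend_lin.
End Descend.

Lemma descendK F (FI : kills F I) : F = fcomp (descend FI) (quotfun I).
Proof.
case: F FI => f m i c l FI.
by apply: functor_eq => x y g; rewrite [RHS]descend_mapE.
Qed.

Lemma kills_fcomp_quotfun (G : functor (quotcat I) D) :
  kills (fcomp G (quotfun I)) I.
Proof.
move=> x y f If /=; have -> : qclass I f = 0; last exact: fmap0.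
by apply/qclassP; rewrite subr0.
Qed.

Lemma descend_fcomp (G : functor (quotcat I) D)
    (GI : kills (fcomp G (quotfun I)) I) :
  descend GI = G.
Proof.
case: G GI => f m i c l GI.
apply: functor_eq => x y; elim/qhom_ind=> g.
exact: (descend_mapE GI).
Qed.

(** [descend] recovers a functor from its composite with the projection.  Going
    through it avoids transporting morphisms along the equality of the object
    maps of [G] and [H]. *)
Lemma fcomp_quotfun_inj (G H : functor (quotcat I) D) :
  fcomp G (quotfun I) = fcomp H (quotfun I) -> G = H.
Proof.
move=> GH; have HI := kills_fcomp_quotfun H.
have GI : kills (fcomp G (quotfun I)) I by rewrite GH.
rewrite -(descend_fcomp GI) -(descend_fcomp HI).
by case: _ / GH HI => HI; rewrite (Prop_irrelevance GI HI).
Qed.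

Lemma factor_through_quotcat (F : functor C D) : kills F I ->
  exists! G : functor (quotcat I) D, F = fcomp G (quotfun I).
Proof.
move=> FI; exists (descend FI); split; first exact: descendK.
by move=> G FG; apply: fcomp_quotfun_inj; rewrite -FG -descendK.
Qed.
End Factorization.

(** * The Casimir element of sp_2 *)

Section Sp2.
Variable K : fieldType.

Lemma actDl (M : sp2mod K) A B (u : M) : act (A + B) u = act A u + act B u.
Proof. exact: (linD (fun a A B => act_linl a A B u)). Qed.

Lemma actZl (M : sp2mod K) a A (u : M) : act (a *: A) u = a *: act A u.
Proof. exact: (linZ (fun a A B => act_linl a A B u)). Qed.

Lemma actNl (M : sp2mod K) A (u : M) : act (- A) u = - act A u.
Proof. exact: (linN (fun a A B => act_linl a A B u)). Qed.

Lemma actN (M : sp2mod K) A (u : M) : act A (- u) = - act A u.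
Proof. exact: (linN (@act_linr _ M A)). Qed.

Lemma sp2hom0 (M N : sp2mod K) (f : sp2hom M N) : f 0 = 0.
Proof. exact: (lin0 (sp2hom_lin f)). Qed.

Lemma sp2homD (M N : sp2mod K) (f : sp2hom M N) u w : f (u + w) = f u + f w.
Proof. exact: (linD (sp2hom_lin f)). Qed.

Lemma sp2homZ (M N : sp2mod K) (f : sp2hom M N) a u : f (a *: u) = a *: f u.
Proof. exact: (linZ (sp2hom_lin f)). Qed.

Lemma sp2homN (M N : sp2mod K) (f : sp2hom M N) u : f (- u) = - f u.
Proof. exact: (linN (sp2hom_lin f)). Qed.

Lemma sp2hom_eq (M N : sp2mod K) (f g : sp2hom M N) : f =1 g -> f = g.
Proof. by move=> fg; apply: val_inj; apply/funext. Qed.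

Local Notation h := (sp2h K).
Local Notation x := (sp2x K).
Local Notation y := (sp2y K).

(** The entry at [1 1] is minus the one at [0 0], matrices in sp_2 being
    traceless. *)
Lemma sp2_eq (A B : sp2 K) : A 0 0 = B 0 0 -> A 0 1 = B 0 1 -> A 1 0 = B 1 0 ->
  A = B.
Proof.
have tr (C : sp2 K) : C 1 1 = - C 0 0.
  have /matrixP/(_ 0 1) := sp2P C.
  rewrite !mxE !big_ord_recl !big_ord0 !mxE /=.
  rewrite !(subr0, sub0r, mulr0, mul0r, addr0, add0r, mulr1, mul1r).
  have -> : lift ord0 ord0 = 1 :> 'I_2 by apply: val_inj.
  by move=> ->; rewrite opprK.
move=> e00 e01 e10; apply: val_inj; apply/matrixP => i j /=.
have ord2 (k : 'I_2) : k = 0 \/ k = 1.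
  by case: k => -[|[|//]] kk; [left|right]; apply: val_inj.
by case: (ord2 i) => ->; case: (ord2 j) => -> //; rewrite !tr e00.
Qed.

Lemma sp2_decomp (A : sp2 K) : A = A 0 0 *: h + A 0 1 *: x + A 1 0 *: y.
Proof.
by apply: sp2_eq; rewrite /= !mxE /= ?(mulr0, mulr1, subr0, addr0, add0r).
Qed.

Lemma lie_hx : lie h x = 2 *: x.
Proof.
apply: sp2_eq; do 5 rewrite ?mxE ?big_ord_recl ?big_ord0 //=; ring.
Qed.

Lemma lie_hy : lie h y = - (2 *: y).
Proof.
apply: sp2_eq; do 5 rewrite ?mxE ?big_ord_recl ?big_ord0 //=; ring.
Qed.

Lemma lie_xy : lie x y = h.
Proof.
apply: sp2_eq; do 5 rewrite ?mxE ?big_ord_recl ?big_ord0 //=; ring.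
Qed.

Lemma X_E : (X_ K 0 0 = h) * (X_ K 1 1 = - h) *
  (X_ K 0 1 = 2 *: x) * (X_ K 1 0 = 2 *: y).
Proof.
do ![split]; apply: sp2_eq; rewrite /= /Xmx /glow invmx_omega /gup;
 do 5 rewrite ?mxE ?big_ord_recl ?big_ord0 //=; ring.
Qed.

Section Module.
Variable M : sp2mod K.
Implicit Types u w : M.

(** Twice the Casimir element dual to the trace form, whose integral
    coefficients avoid a division by 2. *)
Definition casimir u : M :=
  act h (act h u) + 2 *: act x (act y u) + 2 *: act y (act x u).

Lemma act_hx u : act h (act x u) = act x (act h u) + 2 *: act x u.
Proof. by rewrite -actZl -lie_hx act_lie addrC subrK. Qed.

Lemma act_hy u : act h (act y u) = act y (act h u) - 2 *: act y u.
Proof. by rewrite -actZl -actNl -lie_hy act_lie addrC subrK. Qed.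

Lemma act_xy u : act x (act y u) = act y (act x u) + act h u.
Proof. by rewrite -[in act h u]lie_xy act_lie addrC subrK. Qed.

(** The forms with all the [x] on the right, or all on the left, show the
    action on vectors killed by [x], and they make the commutation with [x] and
    [y] short. *)
Lemma casimir_yx u :
  casimir u = act h (act h u) + 2 *: act h u + 4 *: act y (act x u).
Proof.
rewrite /casimir act_xy scalerDr -!addrA (addrCA (2 *: act y _)) -scalerDl.
by congr (_ + (_ + _ *: _)); ring.
Qed.

Lemma casimir_xy u :
  casimir u = act h (act h u) - 2 *: act h u + 4 *: act x (act y u).
Proof.
rewrite casimir_yx act_xy scalerDr -!addrA (addrCA (- _)) -scaleNr -scalerDl.
rewrite [2 *: _ + _]addrC.
by congr (_ + (_ + _ *: _)); ring.
Qed.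

Lemma casimirP a u w : casimir (a *: u + w) = a *: casimir u + casimir w.
Proof.
rewrite /casimir !act_linr !scalerDr !scalerA !(mulrC 2 a) -!scalerA.
by rewrite [X in X + _ = _]addrACA [LHS]addrACA.
Qed.

Lemma casimir0 : casimir 0 = 0.
Proof. exact: (lin0 casimirP). Qed.

Lemma casimirD u w : casimir (u + w) = casimir u + casimir w.
Proof. exact: (linD casimirP). Qed.

Lemma casimirZ a u : casimir (a *: u) = a *: casimir u.
Proof. exact: (linZ casimirP). Qed.

(** Moving [x] or [y] across [h h] shifts the weight by 2: [(h - 2) x = x h]
    turns [h (h - 2) x] into [x h (h + 2)], that is, one of the two ordered forms
    of the Casimir element into the other. *)
Lemma casimir_act A u : casimir (act A u) = act A (casimir u).
Proof.
have Hx : casimir (act x u) = act x (casimir u).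
  rewrite casimir_xy casimir_yx !actD !actZ; congr (_ + _).
  have e w : act h (act x w) - 2 *: act x w = act x (act h w).
    by rewrite act_hx addrK.
  by rewrite -actZ -actN -actD e act_hx.
have Hy : casimir (act y u) = act y (casimir u).
  rewrite casimir_yx casimir_xy !actD actN !actZ; congr (_ + _).
  have e w : act h (act y w) + 2 *: act y w = act y (act h w).
    by rewrite act_hy subrK.
  by rewrite -actZ -actD e act_hy.
have Hh : casimir (act h u) = act h (casimir u).
  rewrite /casimir !actD !actZ; congr (_ + _ *: _ + _ *: _).
    by rewrite act_hx act_hy actD actN actZ -addrA addNr addr0.
  by rewrite act_hy act_hx actD actZ addrK.
rewrite [A]sp2_decomp !actDl !actZl !casimirD.
by rewrite !casimirZ Hh Hx Hy.
Qed.

Definition casimir_scalar (c : K) := forall u, casimir u = c *: u.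
End Module.

Lemma casimir_hom (M N : sp2mod K) (f : sp2hom M N) u :
  casimir (f u) = f (casimir u).
Proof. by rewrite /casimir !(sp2homD, sp2homZ, sp2hom_act). Qed.

(** As the module is generated by its highest weight vector and the Casimir
    element is central, only its value on that vector has to be computed. *)
Lemma casimir_verma lambda :
  casimir_scalar (verma lambda) (lambda ^+ 2 + 2 * lambda).
Proof.
set c := _ + _; elim/pquotW; elim=> [|A e IH||e1 IH1 e2 IH2|a e IH].
- set g : verma lambda := pq _.
  have xg : act x g = 0 by rewrite /= vactE; apply/pqP/veq_x.
  have hg : act h g = lambda *: g by rewrite /= vactE -pqZ; apply/pqP/veq_h.
  rewrite casimir_yx xg act0 scaler0 addr0 !(hg, actZ) !scalerA -scalerDl.
  by congr (_ *: _); rewrite /c; ring.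
- by rewrite -vactE -[vact _ _]/(act A (_ : verma lambda)) casimir_act IH actZ.
- by rewrite -pq0 casimir0 scaler0.
- by rewrite pqD casimirD IH1 IH2 scalerDr.
- by rewrite pqZ casimirZ IH !scalerA mulrC.
Qed.

Lemma casimir_scalar_surj (M N : sp2mod K) (f : sp2hom M N) c :
  (forall u, exists w, f w = u) -> casimir_scalar M c -> casimir_scalar N c.
Proof. by move=> sf Mc u; have [w <-] := sf u; rewrite casimir_hom Mc sp2homZ. Qed.
End Sp2.

(** * Tensors *)

Section PureTensors.
Variables (K : fieldType) (M : sp2mod K) (a b : letter).
Implicit Types (u : letter_mod M a) (w : letter_mod M b).

Lemma pure1D u u' : pure1 (u + u') = pure1 u + pure1 u'.
Proof. exact: (linD (fun c u u' => tpure_linl c u u' (1 : K^o))). Qed.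

Lemma pure1Z c u : pure1 (c *: u) = c *: pure1 u.
Proof. exact: (linZ (fun c u u' => tpure_linl c u u' (1 : K^o))). Qed.

Lemma pure2_linl c u u' w :
  pure2 (c *: u + u') w = c *: pure2 u w + pure2 u' w.
Proof. exact: tpure_linl. Qed.

Lemma pure2_linr c u w w' :
  pure2 u (c *: w + w') = c *: pure2 u w + pure2 u w'.
Proof. by rewrite /pure2 tpure_linl tpure_linr. Qed.

Lemma pure20r u : pure2 u (0 : letter_mod M b) = 0.
Proof. exact: (lin0 (fun c => pure2_linr c u)). Qed.

Lemma pure2Zl c u w : pure2 (c *: u) w = c *: pure2 u w.
Proof. exact: (linZ (fun c u u' => pure2_linl c u u' w)). Qed.

Lemma pure2Zr c u w : pure2 u (c *: w) = c *: pure2 u w.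
Proof. exact: (linZ (fun c => pure2_linr c u)). Qed.

Lemma pure2Nl u w : pure2 (- u) w = - pure2 u w.
Proof. exact: (linN (fun c u u' => pure2_linl c u u' w)). Qed.

Lemma pure2Nr u w : pure2 u (- w) = - pure2 u w.
Proof. exact: (linN (fun c => pure2_linr c u)). Qed.
End PureTensors.

Lemma tpureDr (K : fieldType) (M N : lmodType K) (u : M) (w w' : N) :
  u *t (w + w') = u *t w + u *t w'.
Proof. exact: (linD (fun c => tpure_linr c u)). Qed.

Lemma tpureZr (K : fieldType) (M N : lmodType K) c (u : M) (w : N) :
  u *t (c *: w) = c *: (u *t w).
Proof. exact: (linZ (fun c => tpure_linr c u)). Qed.

Lemma tpureNr (K : fieldType) (M N : lmodType K) (u : M) (w : N) :
  u *t (- w) = - (u *t w).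
Proof. exact: (linN (fun c => tpure_linr c u)). Qed.

Section Words.
Variables (K : fieldType) (M : sp2mod K) (s t : word).
Implicit Types (p q : word_mod M s) (r : word_mod M t).

Lemma word_cat_linl c p q r :
  word_cat (c *: p + q) r = c *: word_cat p r + word_cat q r.
Proof. by have [H _] := word_cat_bil M s t; exact: H. Qed.

Lemma word_catZl c p r : word_cat (c *: p) r = c *: word_cat p r.
Proof. exact: (linZ (fun c p q => word_cat_linl c p q r)). Qed.
End Words.

(** * The image of Z_2 *)

Section EvaluateZ2.
Variables (K : fieldType) (M : sp2mod K).
Hypothesis two_neq0 : 2%:R != 0 :> K.
Local Notation h := (sp2h K).
Local Notation x := (sp2x K).
Local Notation y := (sp2y K).
Local Notation e := (@ebasis K).
Local Notation m1 := (@pure1 K M Lm).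
Local Notation v1 := (@pure1 K M Lv).
Local Notation mv := (@pure2 K M Lm Lv).
Local Notation vv := (@pure2 K M Lv Lv).
Local Notation MPB2 := (MPB (-2%:R : K)).
Local Notation "'II' s" := (idc (s : MPB2)) (at level 9).

Lemma Casimir_actE a b (u : letter_mod M a) (w : letter_mod M b) :
  Casimir_act u w =
  - (pure2 (act h u) (act h w) + 2 *: pure2 (act x u) (act y w)
       + 2 *: pure2 (act y u) (act x w)).
Proof.
rewrite /Casimir_act !big_ord_recl !big_ord0.
have -> : lift ord0 ord0 = 1 :> 'I_2 by apply: val_inj.
rewrite !X_E !actNl !actZl !pure2Zl !pure2Zr !pure2Nl !pure2Nr opprK !addr0.
set P := pure2 _ _; set Q := pure2 _ _; set S := pure2 _ _.
have -> : P + 2 *: (2 *: Q) + (2 *: (2 *: S) + P)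
    = 2 *: (P + 2 *: Q + 2 *: S).
  rewrite !scalerDr -addrA [_ + (_ + P)]addrA [_ + P]addrC addrA.
  by rewrite -{1 2}[P]scale1r -scalerDl addrA.
by rewrite scalerA mulNr mulVf // scaleN1r.
Qed.

Lemma act_ebasis : ((act h (e 0) = e 0) * (act h (e 1) = - e 1)) *
  ((act x (e 0) = 0) * (act x (e 1) = e 0)) *
  ((act y (e 0) = e 1) * (act y (e 1) = 0)).
Proof.
by do ![split]; apply/matrixP => -[[|[|//]] ?] -[[|//] ?];
 rewrite !mxE !big_ord_recl !big_ord0 !mxE /=; ring.
Qed.

Lemma ebasis_dualE : (ebasis_dual K 0 = - e 1) * (ebasis_dual K 1 = e 0).
Proof.
split; rewrite /ebasis_dual /glow invmx_omega !big_ord_recl !big_ord0 !mxE /=.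
  rewrite ?(subr0, sub0r, scaleN1r, oppr0, scale0r, add0r, addr0).
  by congr (- delta_mx _ _); apply: val_inj.
by rewrite ?(subr0, sub0r, scaleN1r, opprK, scale1r, oppr0, scale0r, add0r, addr0).
Qed.

Lemma omega_ebasis :
  ((omega (e 0) (e 0) = 0) * (omega (e 0) (e 1) = 1)) *
  ((omega (e 1) (e 0) = -1) * (omega (e 1) (e 1) = 0)).
Proof.
by do ![split]; rewrite /omega /ebasis;
 do 5 rewrite ?mxE ?big_ord_recl ?big_ord0 //=; ring.
Qed.

Variable F : brauer_functor M.

(** The tempered Casimir on [M (x) V], as a matrix of operators on [M]. *)
Lemma bf_H_ebasis (u : M) :
  (bf_map F (mpb_H _ Lm Lv) (mv u (e 0)) =
     - (mv (act h u) (e 0) + 2 *: mv (act x u) (e 1))) *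
  (bf_map F (mpb_H _ Lm Lv) (mv u (e 1)) =
     mv (act h u) (e 1) - 2 *: mv (act y u) (e 0)).
Proof.
rewrite !bf_H !Casimir_actE !act_ebasis !pure20r !pure2Nr !scaler0 !addr0.
by split; rewrite // opprD opprK.
Qed.

Definition cap_map : hom ([:: Lm; Lv; Lv] : MPB2) ([:: Lm] : MPB _) :=
  mpb_tens (II [:: Lm]) (mpb_diag _ dcap : mpb_hom _ _ _).
Definition H2_map : hom ([:: Lm; Lv; Lv] : MPB2) ([:: Lm; Lv; Lv] : MPB _) :=
  mpb_tens (Hmv2 _) (II [:: Lv]).
Definition cup_map : hom ([:: Lm] : MPB2) ([:: Lm; Lv; Lv] : MPB _) :=
  mpb_tens (II [:: Lm]) (mpb_diag _ dcup : mpb_hom _ _ _).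

(** The right end of the diagram of [Z2]: the strand [V] of [z] is paired
    with [w]. *)
Definition close (z : word_mod M [:: Lm; Lv]) (w : V_mod K) :=
  bf_map F cap_map (word_cat z (v1 w)).

Lemma close_lin w c p q : close (c *: p + q) w = c *: close p w + close q w.
Proof. by rewrite /close word_cat_linl sp2hom_lin. Qed.

Lemma closeD p q w : close (p + q) w = close p w + close q w.
Proof. exact: (linD (close_lin w)). Qed.

Lemma closeZ c p w : close (c *: p) w = c *: close p w.
Proof. exact: (linZ (close_lin w)). Qed.

Lemma closeN p w : close (- p) w = - close p w.
Proof. exact: (linN (close_lin w)). Qed.

Lemma close_pure2 (u : M) (w w' : V_mod K) :
  close (mv u w) w' = omega w w' *: m1 u.
Proof.
rewrite /close.
(* Move the boundary between the two blocks from after the first [V] to after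
   [M]. *)
have -> : word_cat (mv u w) (v1 w') =
  word_cat (m1 u) (vv w w').
  by rewrite /pure2 /pure1 !word_cat_pure /= !scale1r.
rewrite [LHS](bf_tens F (II [:: Lm]) (mpb_diag _ dcap : mpb_hom _ _ _)
  (m1 u) (vv w w')).
rewrite bf_id bf_cap /pure1 word_cat_pure /=.
by rewrite scale1r -tpureZr; congr (_ *t _); rewrite [RHS]mulr1.
Qed.

Lemma bf_H2_map (p : word_mod M [:: Lm; Lv]) (w : V_mod K) :
  bf_map F H2_map (word_cat p (v1 w)) =
  word_cat (bf_map F (mpb_H _ Lm Lv) (bf_map F (mpb_H _ Lm Lv) p)) (v1 w).
Proof.
rewrite [LHS](bf_tens F (Hmv2 (-2%:R)) (II [:: Lv]) p (v1 w)).
have -> : Hmv2 (-2%:R) = (mpb_H _ Lm Lv <o> mpb_H _ Lm Lv : hom (_ : MPB _) _) by [].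
by rewrite bf_id bf_comp.
Qed.

(** The cup creates [- e 0 (x) e 1 + e 1 (x) e 0], on whose left factors the
    matrix of the tempered Casimir is squared. *)
Lemma bf_Z2 (u : M) :
  bf_map F (Z2 (-2%:R)) (m1 u) = (-2%:R) *: m1 (casimir u).
Proof.
have -> : Z2 (-2%:R) = (cap_map <o> H2_map) <o> cup_map by [].
rewrite !bf_comp /=.
have -> : bf_map F cup_map (m1 u) =
    - word_cat (mv u (e 0)) (v1 (e 1))
    + word_cat (mv u (e 1)) (v1 (e 0)).
  have -> : m1 u = word_cat (m1 u) (1 : word_mod M [::]).
    by rewrite /pure1 word_cat_pure /= scale1r.
  rewrite [LHS](bf_tens F (II [:: Lm]) (mpb_diag _ dcup : mpb_hom _ _ _)
    (m1 u) (1 : word_mod M [::])).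
  rewrite bf_id bf_cup !big_ord_recl big_ord0 addr0.
  have -> : lift ord0 ord0 = 1 :> 'I_2 by apply: val_inj.
  rewrite !ebasis_dualE pure2Nr.
  by rewrite /pure2 /pure1 !word_cat_pure /= !scale1r tpureDr tpureNr.
rewrite !(sp2homD, sp2homN) !bf_H2_map.
(* Closing off keeps the diagonal entries of the squared matrix. *)
rewrite -!/(close _ _).
rewrite !(bf_H_ebasis, sp2homN, sp2homD, sp2homZ).
rewrite !(closeD, closeN, closeZ) !close_pure2 !omega_ebasis.
rewrite !(scale0r, scaler0, addr0, add0r, sub0r, scale1r, scaleN1r, scalerN, opprK).
rewrite /casimir !pure1D !pure1Z.
set a := pure1 _; set b := pure1 _; set c := pure1 _.
rewrite subr0 addrACA -!opprD -mulr2n -scaler_nat scaleNr !scalerDr.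
by rewrite addrA addrAC.
Qed.

Lemma bf_Z2r_scalar c r : casimir_scalar M c ->
  bf_map F (mpb_tens (Z2 (-2%:R)) (II (nseq r Lv)) :
    hom (pol r : MPB _) (pol r)) = (-2%:R * c) *: idc (word_mod M (pol r) : sp2cat K).
Proof.
move=> Mc; apply: sp2hom_eq => z.
have E : ((-2%:R * c) *: idc (word_mod M (pol r) : sp2cat K)
  : sp2hom _ _) z = (-2%:R * c) *: z by [].
rewrite [RHS]E {E}; elim/tensor_ind: z => [|u w|p q IHp IHq|a p IHp].
- by rewrite sp2hom0 scaler0.
- have -> : u *t w = word_cat (m1 u) w :> word_mod M (pol r).
    by rewrite /pure1 word_cat_pure /= scale1r.
  rewrite [LHS](bf_tens F (Z2 (-2%:R)) (II (nseq r Lv))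
    (m1 u) w).
  by rewrite bf_Z2 bf_id Mc pure1Z scalerA word_catZl.
- by rewrite sp2homD IHp IHq scalerDr.
- by rewrite sp2homZ IHp !scalerA mulrC.
Qed.
End EvaluateZ2.

Theorem lemma7p2 (R : realType) (lambda : R[i]) (M : sp2mod R[i])
    (hM : sp2iso (verma lambda) M \/ is_simple_quotient M (verma lambda))
    (F : brauer_functor M)
    (FTL : functor (PTL (-2%:R : R[i])) (T_cat M))
    (hFTL : fcomp FTL (PTL_proj (-2%:R : R[i])) = F_restrict F) :
  exists! FTLB : functor (TLB (-2%:R : R[i]) lambda) (T_cat M),
    FTL = fcomp FTLB (TLB_proj (-2%:R : R[i]) lambda).
Proof.
have two_neq0 : 2%:R != 0 :> R[i] by rewrite pnatr_eq0.
(* Either form of [hM] makes [M] an image of the Verma module. *)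
have [f f_surj] : exists f : sp2hom (verma lambda) M, forall u, exists w, f w = u.
  case: hM => [[f [g [_ gK]]]|[_ //]].
  by exists f => u; exists (g u).
have Mc := casimir_scalar_surj f_surj (@casimir_verma _ lambda).
apply: factor_through_quotcat; apply: kills_gen_ideal => _ _ _ [r].
set z : hom (r : PMPB _) (r : PMPB _) :=
  mpb_tens (Z2 (-2%:R)) (idc (nseq r Lv : MPB (-2%:R : R[i]))).
set g := z - Z2_value (-2%:R) lambda *: idc (r : PMPB _).
have Fg : fmap (F_restrict F) g = 0.
  rewrite fmapB fmapZ fmap_id [fmap _ z](bf_Z2r_scalar two_neq0 F r Mc).
  by rewrite -scalerBl; apply/eqP; rewrite scaler_eq0 /Z2_value; apply/orP; left;
     apply/eqP; field.
rewrite -hFTL in Fg; rewrite -[RHS]Fg; congr fmap.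
by rewrite /g fmapB fmapZ fmap_id.
Qed.
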